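(* Let $X$ be a CB process with branching mechanism $\Phi$ given by $(\alpha,\beta,\pi)$, and let $x>0$. Assume that $\alpha>0$ and that the Lévy measure $\pi$ is unbounded, i.e. has unbounded support. Then as $r\to\infty$, $$\mathbf{P}_x\left[\sup_{s\in(0,\infty)}\Delta X_s>r\right]\sim\frac{x}{\alpha}\,\pi(r,\infty).$$
   Context: A branching mechanism is a function $\Phi(\lambda)=\alpha\lambda+\beta\lambda^2+\int_{(0,\infty)}(e^{-\lambda\theta}-1+\lambda\theta)\,\pi(d\theta)$, $\lambda\ge0$, with $\alpha\in\mathbb{R}$, $\beta\ge0$ and $\pi$ a $\sigma$-finite measure on $(0,\infty)$ (the Lévy measure) with $\int_{(0,\infty)}(\theta\wedge\theta^2)\,\pi(d\theta)<\infty$; the case $\Phi\equiv0$ is excluded. A CB process with branching mechanism $\Phi$ is an rcll $[0,\infty)$-valued Markov process $X=(X_t)_{t\ge0}$ such that, writing $\mathbf{P}_x$ for its law when $X_0=x$ and $\mathbf{E}_x$ for the expectation, $\mathbf{E}_x[e^{-\lambda X_t}]=e^{-xv_t(\lambda)}$ for $\lambda\ge0$, where $v_t(\lambda)$ is the unique locally bounded nonnegative solution of $v_t(\lambda)=\lambda-\int_0^t\Phi(v_s(\lambda))\,ds$. $\Delta X_s=X_s-X_{s-}$ for $s>0$. $f(r)\sim g(r)$ means $f(r)/g(r)\to1$. *)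

(* Defs.v *)
From HB Require Import structures.
From mathcomp Require Export all_boot all_order all_algebra.
From mathcomp Require Export all_classical all_reals all_analysis measurable_realfun.

Set Implicit Arguments.
Unset Strict Implicit.
Unset Printing Implicit Defensive.

Import Order.TTheory GRing.Theory Num.Theory numFieldNormedType.Exports.

Local Open Scope classical_set_scope.
Local Open Scope ring_scope.

(* A measure on (0, +oo) is represented as a Borel measure on the real line
   that gives no mass to ]-oo, 0]; see [levy_concentrated] below. *)
Definition branching_mechanism (R : realType) (alpha beta : R)
    (pi : {measure set R -> \bar R}) (lambda : R) : R :=
  alpha * lambda + beta * lambda ^+ 2
  + \int[pi]_(theta in `]0, +oo[)
      (expR (- lambda * theta) - 1 + lambda * theta).

Record is_branching_triple (R : realType) (alpha beta : R)
    (pi : {measure set R -> \bar R}) : Prop := {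
  branching_beta_ge0 : 0 <= beta;
  levy_concentrated : pi `]-oo, 0]%classic = 0%E;
  levy_sigma_finite : sigma_finite (`]0, +oo[%classic : set R) pi;
  levy_moment :
    (\int[pi]_(theta in `]0%R, +oo[) (Num.min theta (theta ^+ 2))%:E < +oo)%E;
  branching_nonzero :
    exists2 lambda : R, 0 <= lambda
      & branching_mechanism alpha beta pi lambda != 0 }.

(* [v t lambda] is v_t(lambda); only the values at t, lambda >= 0 matter.
   Measurability in t is what makes the integral equation meaningful. *)
Record is_cumulant (R : realType) (Phi : R -> R) (v : R -> R -> R) : Prop := {
  cumulant_ge0 : forall t lambda : R, 0 <= t -> 0 <= lambda -> 0 <= v t lambda;
  cumulant_measurable : forall lambda : R, 0 <= lambda ->
    measurable_fun (`[0, +oo[%classic : set R) (fun t : R => v t lambda);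
  cumulant_locally_bounded : forall t lambda : R, 0 <= t -> 0 <= lambda ->
    [bounded v s lambda | s in `[0, t]];
  cumulant_eq : forall t lambda : R, 0 <= t -> 0 <= lambda ->
    v t lambda
    = lambda - \int[@lebesgue_measure R]_(s in `[0, t]) Phi (v s lambda) }.

Section processes.
Context (R : realType) (d : measure_display) (Omega : measurableType d).
Implicit Types (X : R -> Omega -> R) (P : R -> probability Omega R).

(* Processes are indexed by the whole of R, but only times t >= 0 matter. *)
Definition rcll X : Prop := forall w : Omega,
  (forall t : R, 0 <= t -> X u w @[u --> t^'+] --> X t w) /\
  (forall t : R, 0 < t -> cvg (X u w @[u --> t^'-])).

Definition natural_filtration X (t : R) : set (set Omega) :=
  <<s \bigcup_(u in `[0, t]) preimage_set_system setT (X u) measurable >>.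

(* A time-homogeneous Markov process with state space [0, +oo[, given as a
   family of laws: [P x] is the law under which X starts from x >= 0.  The
   values of P at x < 0 are irrelevant. *)
Record is_markov_process X P : Prop := {
  markov_measurable : forall t : R, 0 <= t -> measurable_fun setT (X t);
  markov_ge0 : forall (t : R) w, 0 <= t -> 0 <= X t w;
  markov_start : forall x : R, 0 <= x -> P x [set w | X 0 w = x] = 1%E;
  markov_kernel : forall (t : R) (B : set R),
    0 <= t -> measurable B ->
    measurable_fun (`[0, +oo[%classic : set R)
      (fun x : R => P x (X t @^-1` B));
  markov_property : forall (x s t : R) (A : set Omega) (B : set R),
    0 <= x -> 0 <= s -> 0 <= t ->
    natural_filtration X s A -> measurable B ->
    P x (A `&` X (s + t) @^-1` B)
    = (\int[P x]_(w in A) P (X s w) (X t @^-1` B))%E }.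

Record is_CB_process (Phi : R -> R) X P : Prop := {
  CB_rcll : rcll X;
  CB_markov : is_markov_process X P;
  CB_laplace : exists2 v : R -> R -> R, is_cumulant Phi v &
    forall x t lambda : R, 0 <= x -> 0 <= t -> 0 <= lambda ->
      ('E_(P x)[fun w => expR (- lambda * X t w)]
       = (expR (- x * v t lambda))%:E)%E }.

Definition jump X (s : R) (w : Omega) : R :=
  X s w - lim (X u w @[u --> s^'-]).

Definition sup_jump X (w : Omega) : \bar R :=
  ereal_sup [set (jump X s w)%:E | s in `]0, +oo[].

End processes.

Definition measure_support (R : realType) (mu : set R -> \bar R) : set R :=
  [set y | forall U : set R, open U -> U y -> (0 < mu U)%E].

Definition asymp_equiv (R : realType) (f g : R -> R) : Prop :=
  f r / g r @[r --> +oo] --> (1 : R).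

(* Main.v *)
(* In a time [h] the process started from [y] makes an increment larger than [r]
   with probability [h * y * pi ]r, +oo[ + o(h)], uniformly for bounded [y]: the
   Laplace transform gives the small-time asymptotics of the mean of
   [(1 - u) ^+ 2 * p u] with [u = expR (- (X h - y))] for every polynomial [p]
   (the factor kills the drift), and polynomials approximate a cutoff function.
   Summed over a grid of mesh [h] on [0, T], and since the mean of [X t] is
   [x * expR (- (alpha * t))], the expected number of large grid increments tends
   to [x / alpha * (1 - expR (- (alpha * T))) * pi ]r, +oo[], which bounds the
   probability of a jump from above.  For the lower bound only increments from
   times at which [X] has not yet exceeded [r] are counted; these are disjoint
   events.  The mean lost is at most a constant times the integral of [X T] over
   an event of probability at most [x / r], because [expR (alpha * t) * X t] is
   a martingale, so it vanishes as [r] tends to infinity by uniform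
   integrability.  Right continuity and left limits convert large increments on
   fine grids into jumps. *)
Require Import Defs.
From mathcomp Require Import all_boot all_order all_algebra.
From mathcomp Require Import all_classical all_reals all_analysis measurable_realfun.
From mathcomp Require Import ring lra.

Set Implicit Arguments.
Unset Strict Implicit.
Unset Printing Implicit Defensive.

Import Order.TTheory GRing.Theory Num.Theory numFieldNormedType.Exports.

Local Open Scope classical_set_scope.
Local Open Scope ring_scope.

(** * Polynomial approximation *)

(** Since [pi] may have infinite mass near [0], the indicator of large increments must be
    approximated with an error that [pi] integrates. Approximating the quotient of a cutoff by
    [(1 - u) ^+ 2] achieves this: the error becomes a multiple of [(1 - u) ^+ 2], which at
    [u = expR (- t)] is at most [levy_weight t]. The diffusion coefficient [beta] then enters only
    through the value of the polynomial at [u = 1], and this value is made small.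

    Each approximation also displaces the threshold. The upper bound loses nothing: a jump above [r]
    is also above some [r + 1/(m+1)], so the estimate with the tail at [r] holds for every [r > 0]
    without error. The lower bound needs thresholds slightly above [r] and recovers [r] from right
    continuity of the tail. Its loss comes from the horizon [T], fixed before [r] grows, and from
    paths that exceed [r] before [T].

    The Markov property is given for events about a single later time, whereas an increment involves
    two times; hence the discretizations of the state space. *)

(* Bernstein polynomials through de Casteljau's recursion: evaluated at
   [x \in [0, 1]], [bernstein n f] is the expectation of [f S] for a binomial
   variable [S] with parameters [n] and [x]. *)
Fixpoint bernstein (R : realType) (n : nat) (f : nat -> R) : {poly R} :=
  if n is m.+1 then
    'X * bernstein m (fun k => f k.+1) + (1 - 'X) * bernstein m f
  else (f 0%N)%:P.

Lemma le_bernstein (R : realType) n (f g : nat -> R) (x : R) :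
  0 <= x <= 1 -> (forall k, f k <= g k) ->
  (bernstein n f).[x] <= (bernstein n g).[x].
Proof.
move=> /andP[x0 x1]; elim: n f g => [|n IH] f g fg; first by rewrite /= !hornerE.
rewrite /= !hornerE; apply: lerD; apply: ler_wpM2l => //; last exact: IH.
- exact: IH.
- by rewrite subr_ge0.
Qed.

(** The recursion shifts the centre to [c - 1], so [c] must stay free in the induction. The two
    summands multiplied by [b] are the squared bias and the binomial variance. *)
Lemma bernstein_sqr (R : realType) n (a b c x : R) :
  (bernstein n (fun k => a + b * (k%:R - c) ^+ 2)).[x] =
  a + b * ((n%:R * x - c) ^+ 2 + n%:R * x * (1 - x)).
Proof.
elim: n c => [|n IH] c; first by rewrite /= !hornerE; ring.
rewrite /= !hornerE.
have -> : (fun k => a + b * (k.+1%:R - c) ^+ 2) =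
          (fun k => a + b * (k%:R - (c - 1)) ^+ 2).
  by apply/funext => k; rewrite -natr1; congr (_ + _ * _ ^+ 2); ring.
by rewrite !IH -natr1; ring.
Qed.

(** A deviation [y = k / N - x] satisfies [|y| <= d + y^2 / d], which trades the absolute value for
    a quadratic function whose binomial mean is explicit; the variance of [k / N] is at most
    [1 / N]. *)
Lemma lipschitz_bernstein (R : realType) (L : R) (f : R -> R) (d : R) n :
  0 <= L -> 0 < d ->
  (forall u v, 0 <= u -> 0 <= v -> `|f u - f v| <= L * `|u - v|) ->
  forall x, 0 <= x <= 1 ->
  `|(bernstein n.+1 (fun k => f (k%:R / n.+1%:R))).[x] - f x|
    <= L * (d + (d * n.+1%:R)^-1).
Proof.
move=> L0 d0 fL x x01; have /andP[x0 x1] := x01.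
have n0 : (0 : R) < n.+1%:R by [].
set N : R := n.+1%:R.
have N0 : 0 < N by [].
set b := L / (d * N ^+ 2).
have b0 : 0 <= b by rewrite /b divr_ge0 ?mulr_ge0 ?sqr_ge0 // ltW.
have key k : `|f (k%:R / N) - f x| <= L * d + b * (k%:R - N * x) ^+ 2.
  apply: (le_trans (fL _ _ _ x0)); first by rewrite divr_ge0 // ltW.
  have -> : k%:R / N - x = (k%:R - N * x) / N by field; lra.
  set z := k%:R - N * x.
  have -> : L * d + b * z ^+ 2 = L * (d + (z / N) ^+ 2 / d).
    by rewrite /b; field; lra.
  apply: ler_wpM2l => //.
  set y := z / N.
  have -> : y ^+ 2 = `|y| ^+ 2 by rewrite real_normK ?num_real.
  have y0 : 0 <= `|y| by [].
  have : 0 <= (`|y| - d) ^+ 2 by exact: sqr_ge0.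
  move: y0; move: (`|y|) => w w0 H.
  rewrite -(ler_pM2r d0) mulrDl divfK ?gt_eqF //.
  by nra.
have bound : L * d + b * (N * x * (1 - x)) <= L * (d + (d * N)^-1).
  rewrite [leRHS]mulrDr lerD2l.
  have -> : b * (N * x * (1 - x)) = L * (d * N)^-1 * (x * (1 - x)).
    by rewrite /b; field; lra.
  rewrite -[leRHS]mulr1; apply: ler_wpM2l; last by nra.
  by rewrite mulr_ge0 // invr_ge0 mulr_ge0 // ltW.
have E a c : (bernstein n.+1 (fun k => a + c * (k%:R - N * x) ^+ 2)).[x]
    = a + c * (N * x * (1 - x)).
  by rewrite bernstein_sqr subrr expr0n add0r.
rewrite ler_distl; apply/andP; split.
- have : (bernstein n.+1 (fun k => (f x - L * d)
      + (- b) * (k%:R - N * x) ^+ 2)).[x] <=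
     (bernstein n.+1 (fun k => f (k%:R / N))).[x].
    apply: le_bernstein => // k; have := key k.
    by rewrite ler_norml => /andP[]; lra.
  rewrite E mulNr => H; move: bound H.
  by move: (L * (d + _)) (b * _) (L * d) => u v w; lra.
- have : (bernstein n.+1 (fun k => f (k%:R / N))).[x] <=
    (bernstein n.+1 (fun k => (f x + L * d)
      + b * (k%:R - N * x) ^+ 2)).[x].
    apply: le_bernstein => // k; have := key k.
    by rewrite ler_norml => /andP[]; lra.
  rewrite E => H; move: bound H.
  by move: (L * (d + _)) (b * _) (L * d) => u v w; lra.
Qed.

Lemma lipschitz_poly_approx (R : realType) (K L : R) (f : R -> R) (e : R) :
  0 < K -> 0 <= L -> 0 < e ->
  (forall u v, 0 <= u -> 0 <= v -> `|f u - f v| <= L * `|u - v|) ->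
  exists p : {poly R}, forall u, 0 <= u <= K -> `|p.[u] - f u| <= e.
Proof.
move=> K0 L0 e0 fL.
pose M := L * K + 1.
have M0 : 0 < M by rewrite ltr_wpDl // mulr_ge0 // ltW.
(* [M * (d + d) = e], and [n] is taken so large that the variance term is at most [d]. *)
pose d := e / (2 * M).
have d0 : 0 < d by rewrite divr_gt0 // mulr_gt0.
pose n := Num.bound ((d * d)^-1).
have nd : (d * n.+1%:R)^-1 <= d.
  have : (d * d)^-1 < n.+1%:R.
    apply: (@lt_trans _ _ n%:R); last by rewrite ltr_nat.
    by apply: archi_boundP; rewrite invr_ge0 mulr_ge0 // ltW.
  rewrite -[X in X < _]mul1r ltr_pdivrMr; last exact: mulr_gt0.
  by rewrite -[X in X <= _]mul1r ler_pdivrMr; [lra|exact: mulr_gt0].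
have LK u v : 0 <= u -> 0 <= v -> `|f (K * u) - f (K * v)| <= M * `|u - v|.
  move=> u0 v0; apply: (le_trans (fL _ _ _ _)); rewrite ?mulr_ge0 // ?(ltW K0) //.
  rewrite -mulrBr normrM (gtr0_norm K0) mulrA ler_wpM2r //.
  by rewrite /M; lra.
have B := lipschitz_bernstein n (ltW M0) d0 LK.
exists (bernstein n.+1 (fun k => f (K * (k%:R / n.+1%:R))) \Po (K^-1 *: 'X)).
move=> u /andP[u0 uK].
rewrite horner_comp hornerZ hornerX.
have := B (K^-1 * u); rewrite mulrA divff ?gt_eqF // mul1r => H.
apply: (le_trans (H _)).
  by rewrite mulrC divr_ge0 ?(ltW K0) //= ler_pdivrMr // mul1r.
apply: (@le_trans _ _ (M * (d + d))); first by rewrite ler_pM2l // lerD2l.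
suff -> : M * (d + d) = e by [].
by rewrite /d; field; lra.
Qed.

(** * Branching mechanism *)

Section real_integrable.
Context (d : measure_display) (T : measurableType d) (R : realType).
Context (mu : {measure set T -> \bar R}) (D : set T) (mD : measurable D).

Lemma integrableZlr (c : R) (f : T -> R) : mu.-integrable D (EFin \o f) ->
  mu.-integrable D (EFin \o (fun t => c * f t)).
Proof. by move=> fi; apply: eq_integrable (integrableZl _ c fi). Qed.

Lemma integrableDr (f g : T -> R) : mu.-integrable D (EFin \o f) ->
  mu.-integrable D (EFin \o g) ->
  mu.-integrable D (EFin \o (fun t => f t + g t)).
Proof. by move=> fi gi; apply: eq_integrable (integrableD _ fi gi). Qed.

Lemma integrableBr (f g : T -> R) : mu.-integrable D (EFin \o f) ->
  mu.-integrable D (EFin \o g) ->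
  mu.-integrable D (EFin \o (fun t => f t - g t)).
Proof. by move=> fi gi; apply: eq_integrable (integrableB _ fi gi). Qed.

End real_integrable.

Definition levy_kernel (R : realType) (l t : R) : R := expR (- l * t) - 1 + l * t.

Definition levy_weight (R : realType) (t : R) : R := Num.min t (t ^+ 2).

Lemma expRN_le1 (R : realType) (z : R) : 0 <= z -> expR (- z) <= 1.
Proof. by move=> z0; rewrite -expR0 ler_expR oppr_le0. Qed.

Lemma expRN_ge (R : realType) (z : R) : 1 - z <= expR (- z).
Proof. exact: expR_ge1Dx. Qed.

(** [(1 + z) * expR (- z) <= 1], while [(1 + z) * (1 - z + z^2) = 1 + z^3]. *)
Lemma expRN_le_sqr (R : realType) (z : R) : 0 <= z -> expR (- z) <= 1 - z + z ^+ 2.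
Proof.
move=> z0; have z1 : 0 < 1 + z by lra.
rewrite -(ler_pM2r z1); apply: (@le_trans _ _ 1).
  apply: (@le_trans _ _ (expR (- z) * expR z)).
    by rewrite ler_pM2l ?expR_gt0 // expR_ge1Dx.
  by rewrite -expRD addNr expR0.
have : 0 <= z ^+ 3 by exact: exprn_ge0.
by rewrite !exprS expr0; nra.
Qed.

Lemma levy_weight_ge0 (R : realType) (t : R) : 0 <= t -> 0 <= levy_weight t.
Proof. by move=> t0; rewrite /levy_weight le_min t0 sqr_ge0. Qed.

Lemma levy_kernel_ge0 (R : realType) (l t : R) : 0 <= levy_kernel l t.
Proof.
rewrite /levy_kernel mulNr; have := expRN_ge (l * t); lra.
Qed.

Lemma levy_kernel_le_lin (R : realType) (l t : R) :
  0 <= l -> 0 <= t -> levy_kernel l t <= l * t.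
Proof.
move=> l0 t0; rewrite /levy_kernel mulNr.
have := expRN_le1 (mulr_ge0 l0 t0); lra.
Qed.

Lemma levy_kernel_le_sqr (R : realType) (l t : R) :
  0 <= l -> 0 <= t -> levy_kernel l t <= (l * t) ^+ 2.
Proof.
move=> l0 t0; rewrite /levy_kernel mulNr.
have := expRN_le_sqr (mulr_ge0 l0 t0); lra.
Qed.

Lemma levy_kernel_le (R : realType) (l t : R) :
  0 <= l -> 0 <= t -> levy_kernel l t <= (l + l ^+ 2) * levy_weight t.
Proof.
move=> l0 t0; have l2 : 0 <= l ^+ 2 by exact: sqr_ge0.
rewrite /levy_weight; have [tt|tt] := leP t (t ^+ 2).
  by apply: (le_trans (levy_kernel_le_lin l0 t0)); nra.
apply: (le_trans (levy_kernel_le_sqr l0 t0)); rewrite exprMn.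
by apply: ler_wpM2r; [exact: sqr_ge0|lra].
Qed.

(** With [A = a * t] and [D = (b - a) * t] the difference is [D - expR (- A) * (1 - expR (- D))]. It
    is at most [D], which serves for large [t], and at most [D * A + D^2 = b * (b - a) * t^2], which
    serves for small [t]; the factor [1 + M] covers both. *)
Lemma levy_kernel_lip (R : realType) (M a b t : R) :
  0 <= a -> a <= b -> b <= M -> 0 <= t ->
  0 <= levy_kernel b t - levy_kernel a t
    <= (1 + M) * (b - a) * levy_weight t.
Proof.
move=> a0 ab bM t0.
have b0 : 0 <= b by lra.
have d0 : 0 <= (b - a) * t by rewrite mulr_ge0 // subr_ge0.
have at0 : 0 <= a * t by rewrite mulr_ge0.
have E : levy_kernel b t - levy_kernel a t =
    expR (- (a * t)) * (expR (- ((b - a) * t)) - 1) + (b - a) * t.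
  rewrite /levy_kernel.
  have -> : - b * t = - (a * t) + - ((b - a) * t) by ring.
  by rewrite mulNr expRD; ring.
rewrite {}E.
have := expRN_ge ((b - a) * t); have := expRN_le1 d0.
have := expRN_le_sqr d0; have := expRN_le1 at0; have := expRN_ge (a * t).
have := expR_gt0 (- (a * t)); have := expR_gt0 (- ((b - a) * t)).
set x := expR (- (a * t)); set y := expR (- ((b - a) * t)).
set D := (b - a) * t in d0 *; set A := a * t in at0 *.
move=> y0 x0 xA x1 yD2 y1 yD.
apply/andP; split.
  have : 0 <= (1 - x) * (1 - y) by apply: mulr_ge0; lra.
  have : x * (y - 1) = (1 - x) * (1 - y) + (y - 1) by ring.
  by lra.
rewrite /levy_weight; have [tt|tt] := leP t (t ^+ 2).
  have : x * (1 - y) >= 0 by apply: mulr_ge0; lra.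
  have : D <= (1 + M) * (b - a) * t.
    rewrite -mulrA -/D; have : 0 <= M * D by apply: mulr_ge0; lra.
    by lra.
  by lra.
have h1 : x * (y - 1) <= x * (- D + D ^+ 2) by rewrite ler_pM2l //; lra.
have h2 : D * (1 - x) <= D * A by apply: ler_wpM2l => //; lra.
have h3 : x * D ^+ 2 <= 1 * D ^+ 2 by apply: ler_wpM2r => //; exact: sqr_ge0.
have h4 : D * A + D ^+ 2 = (b * (b - a)) * t ^+ 2 by rewrite /D /A; ring.
have h5 : (b * (b - a)) * t ^+ 2 <= ((1 + M) * (b - a)) * t ^+ 2.
  by apply: ler_wpM2r; [exact: sqr_ge0|apply: ler_wpM2r; lra].
by nra.
Qed.

Lemma measurable_levy_weight (R : realType) (D : set R) :
  measurable_fun D (@levy_weight R).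
Proof.
apply: measurable_funTS; exact: measurable_minr.
Qed.

Lemma measurable_levy_kernel (R : realType) (l : R) (D : set R) :
  measurable_fun D (levy_kernel l).
Proof.
apply: measurable_funTS; apply: measurable_funD; last exact: measurable_funM.
by apply: measurable_funB => //; exact: measurableT_comp.
Qed.

Section levy_measure.
Context (R : realType) (alpha beta : R) (pi : {measure set R -> \bar R}).
Context (hPhi : is_branching_triple alpha beta pi).
Let D : set R := `]0, +oo[%classic.
Let mD : measurable D.
Proof. exact: measurable_itv. Qed.
Let Phi := branching_mechanism alpha beta pi.

Definition levy_mass : R := \int[pi]_(t in `]0, +oo[) levy_weight t.

Let DP t : D t -> 0 < t.
Proof. by rewrite /D /= in_itv /= andbT. Qed.

Lemma levy_weight_integrable : pi.-integrable D (EFin \o @levy_weight R).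
Proof.
apply/integrableP; split.
  by apply/measurable_EFinP; exact: measurable_levy_weight.
apply: le_lt_trans (levy_moment hPhi); rewrite le_eqVlt; apply/orP; left.
apply/eqP; apply: eq_integral => t; rewrite inE => /DP t0 /=.
by rewrite ger0_norm // levy_weight_ge0 // ltW.
Qed.

Lemma levy_integrable (f : R -> R) (C : R) : measurable_fun D f ->
  (forall t, 0 < t -> `|f t| <= C * levy_weight t) ->
  pi.-integrable D (EFin \o f).
Proof.
move=> mf fC.
have : pi.-integrable D (EFin \o (fun t => C * levy_weight t)).
  apply: eq_integrable (integrableZl _ C levy_weight_integrable) => //.
apply: le_integrable => //; first exact/measurable_EFinP.
move=> t /DP t0 /=; rewrite lee_fin; apply: (le_trans (fC t t0)).
exact: ler_norm.
Qed.

Lemma levy_integral_le (f : R -> R) (C : R) : measurable_fun D f ->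
  (forall t, 0 < t -> `|f t| <= C * levy_weight t) ->
  `|\int[pi]_(t in D) f t| <= C * levy_mass.
Proof.
move=> mf fC; have intf := levy_integrable mf fC.
apply: (le_trans (le_normr_Rintegral mD intf)).
rewrite /levy_mass -(RintegralZl C mD levy_weight_integrable).
apply: le_Rintegral => //.
- exact: (integrable_norm intf).
- exact: integrableZlr levy_weight_integrable.
- by move=> t /DP; exact: fC.
Qed.

Lemma levy_mass_ge0 : 0 <= levy_mass.
Proof. by apply: Rintegral_ge0 => t /DP t0; rewrite levy_weight_ge0 // ltW. Qed.

Lemma levy_kernel_integrable l : 0 <= l ->
  pi.-integrable D (EFin \o levy_kernel l).
Proof.
move=> l0; apply: (@levy_integrable _ (l + l ^+ 2)).
  exact: measurable_levy_kernel.
move=> t t0; rewrite ger0_norm ?levy_kernel_ge0 //.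
by apply: levy_kernel_le => //; exact: ltW.
Qed.

Lemma branching_mechanismE l :
  Phi l = alpha * l + beta * l ^+ 2 + \int[pi]_(t in D) levy_kernel l t.
Proof. by []. Qed.

Lemma branching_mechanism_ge l : 0 <= l -> alpha * l <= Phi l.
Proof.
move=> l0; rewrite branching_mechanismE.
have : 0 <= beta * l ^+ 2.
  by rewrite mulr_ge0 ?sqr_ge0 // (branching_beta_ge0 hPhi).
have : 0 <= \int[pi]_(t in D) levy_kernel l t.
  by apply: Rintegral_ge0 => t _; exact: levy_kernel_ge0.
by lra.
Qed.

(** A Lipschitz bound on bounded intervals stands in for differentiability of [Phi]: it gives
    continuity of [Phi] along the cumulant and the second-order error of the small-time
    expansion. *)
Lemma branching_mechanism_lip M : 0 <= M -> exists2 L, 0 <= L &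
  forall a b, 0 <= a <= M -> 0 <= b <= M -> `|Phi a - Phi b| <= L * `|a - b|.
Proof.
move=> M0; have b0 := branching_beta_ge0 hPhi; have m0 := levy_mass_ge0.
pose L := `|alpha| + 2 * beta * M + (1 + M) * levy_mass.
have L0 : 0 <= L.
  rewrite /L; apply: addr_ge0; last by apply: mulr_ge0 => //; lra.
  by apply: addr_ge0 => //; rewrite !mulr_ge0.
exists L => //.
suff H a b : 0 <= a -> a <= b -> b <= M -> `|Phi a - Phi b| <= L * `|a - b|.
  move=> a b /andP[a0 aM] /andP[b0' bM].
  have [ab|ba] := leP a b; first exact: H.
  by rewrite distrC (distrC a); apply: H => //; exact: ltW.
move=> a0 ab bM; have b0' := le_trans a0 ab.
rewrite distrC (distrC a) (ger0_norm (x := b - a)) ?subr_ge0 //.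
rewrite !branching_mechanismE.
set ka := \int[pi]_(t in D) levy_kernel a t.
set kb := \int[pi]_(t in D) levy_kernel b t.
have -> : alpha * b + beta * b ^+ 2 + kb - (alpha * a + beta * a ^+ 2 + ka) =
  alpha * (b - a) + beta * (b + a) * (b - a) + (kb - ka) by ring.
have kl : `|kb - ka| <= (1 + M) * (b - a) * levy_mass.
  rewrite /kb /ka -(RintegralB mD (levy_kernel_integrable b0')
    (levy_kernel_integrable a0)).
  apply: levy_integral_le.
    by apply: measurable_funB; exact: measurable_levy_kernel.
  move=> t /ltW t0; have /andP[h0 h1] := levy_kernel_lip a0 ab bM t0.
  by rewrite ger0_norm.
apply: (le_trans (ler_normD _ _)).
rewrite /L mulrDl; apply: lerD; last by rewrite mulrAC.
apply: (le_trans (ler_normD _ _)).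
rewrite mulrDl; apply: lerD.
  by rewrite normrM (ger0_norm (x := b - a)) ?subr_ge0.
rewrite ger0_norm; last by rewrite !mulr_ge0 // ?subr_ge0 //; lra.
apply: ler_wpM2r; first by rewrite subr_ge0.
by rewrite (mulrC 2) -mulrA; apply: ler_wpM2l => //; lra.
Qed.

(** Together with [branching_mechanism_ge] this says that [alpha] is the right derivative of [Phi]
    at [0], which is what fixes the decay rate of the mean. *)
Lemma branching_mechanism_small e : 0 < e ->
  exists2 l0, 0 < l0 & forall l, 0 <= l <= l0 -> Phi l <= (alpha + e) * l.
Proof.
move=> e0; have b0 := branching_beta_ge0 hPhi.
(* For [l <= 1 / (n+1)] the kernel is at most [l * g n], by its linear and quadratic bounds; and
   [g n] decreases to [0] below [levy_weight], so its integral vanishes by dominated convergence. *)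
pose g (n : nat) (t : R) := Num.min t (t ^+ 2 / n.+1%:R).
have mg n : measurable_fun D (g n).
  apply: measurable_funTS; apply: measurable_minr => //.
  by apply: measurable_funM => //; exact: measurable_funX.
have gw n t : 0 < t -> `|g n t| <= 1 * levy_weight t.
  move=> t0; rewrite mul1r ger0_norm; last first.
    by rewrite /g le_min (ltW t0) /= mulr_ge0 ?sqr_ge0.
  rewrite /g /levy_weight le_min !ge_min lexx /=; apply/orP; right.
  by rewrite ler_pdivrMr // ler_peMr ?sqr_ge0 // ler1n.
have gi n : pi.-integrable D (EFin \o g n) by exact: levy_integrable (gw n).
have cg : (\int[pi]_(t in D) (EFin \o g n) t)%E @[n --> \oo]
    --> (\int[pi]_(t in D) cst 0 t)%E.
  apply: (@dominated_cvg _ _ _ _ _ _ _ _ (EFin \o @levy_weight R)) => //.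
  - by move=> n; apply/measurable_EFinP.
  - move=> t /DP t0; apply/cvg_EFin; first by apply: nearW.
    rewrite [X in X @ _ --> _](_ : _ = fun n => g n t) //.
    apply: (@squeeze_cvgr _ _ _ _ (cst 0) (fun n => t ^+ 2 * n.+1%:R^-1)).
    + apply: nearW => n; rewrite /g le_min (ltW t0) /= mulr_ge0 ?sqr_ge0 //=.
      by rewrite ge_min lexx orbT.
    + exact: cvg_cst.
    + rewrite -[X in _ --> X](mulr0 (t ^+ 2)); apply: cvgMl_tmp.
      exact: cvg_harmonic.
  - exact: levy_weight_integrable.
  - move=> n t /DP t0 /=; rewrite lee_fin.
    by have := gw n t t0; rewrite mul1r.
rewrite integral0 in cg.
have cg' : \int[pi]_(t in D) g n t @[n --> \oo] --> (0 : R).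
  exact: (fine_cvg cg).
have := cg' => /cvgrPdist_lt /(_ (e / 2)); rewrite divr_gt0 // => /(_ isT) [N _ HN].
have {HN} := HN N (leqnn _); rewrite /= sub0r normrN => HN.
have {}HN : \int[pi]_(t in D) g N t < e / 2 by apply: le_lt_trans HN; exact: ler_norm.
pose l1 := e / (2 * (beta + 1)).
have l10 : 0 < l1 by rewrite divr_gt0 // mulr_gt0 //; lra.
have l1e : beta * l1 <= e / 2.
  have -> : e / 2 = (beta + 1) * l1 by rewrite /l1; field; lra.
  by rewrite ler_pM2r //; lra.
exists (Num.min l1 (N.+1%:R^-1)).
  by rewrite lt_min l10 /= invr_gt0.
move=> l /andP[l0]; rewrite le_min => /andP[ll1 lN].
rewrite branching_mechanismE mulrDl.
have h1 : beta * l ^+ 2 <= e / 2 * l.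
  rewrite expr2 mulrA; apply: ler_wpM2r => //.
  by apply: le_trans l1e; exact: ler_wpM2l.
have h2 : \int[pi]_(t in D) levy_kernel l t <= l * \int[pi]_(t in D) g N t.
  rewrite -(RintegralZl l mD (gi N)); apply: le_Rintegral => //.
  - exact: levy_kernel_integrable.
  - exact: integrableZlr.
  - move=> t /DP /ltW t0; rewrite /g; case: (leP t) => _.
      exact: levy_kernel_le_lin.
    apply: (le_trans (levy_kernel_le_sqr l0 t0)).
    rewrite exprMn expr2 -mulrA; apply: ler_wpM2l => //.
    by rewrite mulrC; apply: ler_wpM2l => //; exact: sqr_ge0.
have h3 : l * \int[pi]_(t in D) g N t <= e / 2 * l.
  by rewrite mulrC; apply: ler_wpM2r => //; exact: ltW.
by move: h1 h2 h3; lra.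
Qed.

Lemma one_sub_expRN_sqr_le (t : R) : 0 <= t ->
  0 <= (1 - expR (- t)) ^+ 2 <= levy_weight t.
Proof.
move=> t0; rewrite sqr_ge0 /= /levy_weight le_min.
have := expRN_ge t; have := expRN_le1 t0; have := expR_gt0 (- t).
move: (expR (- t)) => u u0 u1 ut; rewrite !expr2.
by apply/andP; split; nra.
Qed.

(** A second difference of step [1] annihilates the part of [Phi] linear in the argument,
    compensator included, and turns [beta * l ^+ 2] into [2 * beta]. What remains is the
    [pi]-integral of [u^l * (1 - u)^2] at [u = expR (- t)]. *)
Lemma branching_second_difference l : 0 <= l ->
  Phi l - 2 * Phi (l + 1) + Phi (l + 2) =
  2 * beta + \int[pi]_(t in D) (expR (- l * t) * (1 - expR (- t)) ^+ 2).
Proof.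
move=> l0; rewrite !branching_mechanismE.
have i0 := levy_kernel_integrable l0.
have i1 : pi.-integrable D (EFin \o levy_kernel (l + 1)).
  by apply: levy_kernel_integrable; lra.
have i2 : pi.-integrable D (EFin \o levy_kernel (l + 2)).
  by apply: levy_kernel_integrable; lra.
have -> : \int[pi]_(t in D) (expR (- l * t) * (1 - expR (- t)) ^+ 2) =
  \int[pi]_(t in D) (levy_kernel l t - 2 * levy_kernel (l + 1) t
    + levy_kernel (l + 2) t).
  apply: eq_Rintegral => t _; rewrite /levy_kernel.
  have -> : - (l + 1) * t = - l * t - t by ring.
  have -> : - (l + 2) * t = - l * t - t - t by ring.
  by rewrite !expRD; ring.
rewrite RintegralD //; last first.
  by apply: integrableBr => //; exact: integrableZlr.
rewrite RintegralB //; last exact: integrableZlr.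
by rewrite RintegralZl //; ring.
Qed.

Definition levy_tail (r : R) : R := fine (pi `]r, +oo[%classic).

(** Markov's inequality for [levy_weight], which is at least [c] beyond [r]. *)
Lemma levy_tail_fin (r : R) : 0 < r -> pi `]r, +oo[%classic \is a fin_num.
Proof.
move=> r0; pose c := Num.min r (r ^+ 2).
have c0 : 0 < c by rewrite /c lt_min r0 exprn_gt0.
rewrite ge0_fin_numE //.
have sub : `]r, +oo[%classic `<=` D.
  by move=> t; rewrite /D /= !in_itv /= !andbT; exact: lt_trans.
have : (c%:E * pi `]r, +oo[%classic <= \int[pi]_(t in D) (levy_weight t)%:E)%E.
  rewrite -integral_cst //.
  apply: (@le_trans _ _ (\int[pi]_(t in `]r, +oo[) (levy_weight t)%:E)%E).
    apply: ge0_le_integral => //.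
    - by move=> t _; rewrite lee_fin ltW.
    - by apply/measurable_EFinP; exact: measurable_levy_weight.
    - move=> t; rewrite /= in_itv /= andbT => rt.
      rewrite lee_fin /c /levy_weight le_min !ge_min (ltW rt) /=; apply/orP; right.
      by rewrite ler_pXn2r // ?nnegrE ?ltW // (lt_trans r0).
  apply: ge0_subset_integral => //.
    by apply/measurable_EFinP; exact: measurable_levy_weight.
  by move=> t /DP /ltW t0; rewrite lee_fin levy_weight_ge0.
move=> /le_lt_trans /(_ (levy_moment hPhi)).
case: (pi _) (measure_ge0 pi `]r, +oo[%classic) => [s||] // _.
  by move=> _; exact: ltry.
by rewrite gt0_muley ?lte_fin.
Qed.

Lemma levy_tail_ge0 r : 0 <= levy_tail r.
Proof. by rewrite /levy_tail fine_ge0. Qed.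

Lemma levy_tailE r : 0 < r -> pi `]r, +oo[%classic = (levy_tail r)%:E.
Proof. by move=> r0; rewrite /levy_tail fineK // levy_tail_fin. Qed.

(** If the tail at [r] vanished, the support would lie in [[-r, r]]: a point beyond [r] has the null
    neighbourhood []r, +oo[], and a negative one the null neighbourhood []-oo, 0[]. Positivity makes
    the quotient in the asymptotic equivalence meaningful. *)
Lemma levy_tail_gt0 r : 0 < r -> ~ bounded_set (measure_support pi) ->
  0 < levy_tail r.
Proof.
move=> r0 nb; rewrite lt_neqAle levy_tail_ge0 andbT; apply/negP => /eqP H.
apply: nb; exists r; split; first exact: num_real.
move=> s rs y /= sy; rewrite leNgt; apply/negP => ys.
have [y0|y0] := leP y 0.
- have : (0 < pi `]-oo, 0%R[%classic)%E.
    apply: sy; first exact: interval_open.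
    rewrite /= in_itv /=; rewrite ler0_norm // in ys.
    by have := lt_trans r0 (lt_trans rs ys); lra.
  apply/negP; rewrite -leNgt -(levy_concentrated hPhi).
  apply: le_measure; rewrite ?inE //.
  by move=> t; rewrite /= !in_itv /=; exact: ltW.
- rewrite gtr0_norm // in ys.
  have : (0 < pi `]r, +oo[%classic)%E.
    apply: sy; first exact: interval_open.
    by rewrite /= in_itv /= andbT (lt_trans rs).
  by rewrite levy_tailE // -H ltxx.
Qed.

(** Right continuity of the tail, from continuity of [pi] along increasing sets; it closes the gap
    between thresholds in the lower bound. *)
Lemma levy_tail_cont r c : 0 < r -> c < levy_tail r ->
  exists2 r', r < r' & c < levy_tail r'.
Proof.
move=> r0 cr.
pose F (n : nat) := `](r + n.+1%:R^-1), +oo[%classic : set R.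
have FU : \bigcup_n F n = `]r, +oo[%classic.
  apply/seteqP; split => [t [n _]|t].
    rewrite /F /= !in_itv /= !andbT; apply: lt_trans.
    by rewrite ltrDl invr_gt0.
  rewrite /= in_itv /= andbT => rt.
  have tr : 0 < t - r by rewrite subr_gt0.
  have [n _ /(_ n (leqnn _))] := near_infty_natSinv_lt (PosNum tr).
  move=> /= H; exists n => //; rewrite /F /= in_itv /= andbT.
  by rewrite addrC -ltrBrDr.
have := @nondecreasing_cvg_mu _ _ _ pi F.
rewrite FU levy_tailE // => H.
have {}H : (pi \o F) n @[n --> \oo] --> (levy_tail r)%:E.
  apply: H => // [i|n m nm]; first exact: measurable_itv.
  apply/subsetPset => t; rewrite /F /= !in_itv /= !andbT.
  by apply: le_lt_trans; rewrite lerD2l lef_pV2 ?posrE // ler_nat.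
have H2 : fine ((pi \o F) n) @[n --> \oo] --> levy_tail r by exact: (fine_cvg H).
have [N _ /(_ N (leqnn _))] := cvgr_gt _ H2 _ cr.
by move=> /= HN; exists (r + N.+1%:R^-1) => //; rewrite ltrDl invr_gt0.
Qed.

End levy_measure.

(** * Cumulant *)

Lemma lipschitz_continuous (R : realType) (f : R -> R) (L : R) :
  (forall x y, `|f x - f y| <= L * `|x - y|) -> continuous f.
Proof.
move=> fL x; apply/cvgrPdist_le => e e0.
pose M := `|L| + 1.
have M0 : 0 < M by rewrite ltr_wpDl.
near=> y; apply: (le_trans (fL _ _)); apply: (@le_trans _ _ (M * `|x - y|)).
  by apply: ler_wpM2r => //; rewrite /M; have := ler_norm L; lra.
rewrite mulrC -ler_pdivlMr //; near: y; apply: cvgr_dist_le => //.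
by rewrite divr_gt0.
Unshelve. all: by end_near. Qed.

Lemma clamp_lip (R : realType) (l x y : R) : 0 <= l ->
  `|Num.max 0 (Num.min l x) - Num.max 0 (Num.min l y)| <= `|x - y|.
Proof.
move=> l0; have := ler_norm (x - y); have := lerNnormlW (lexx `|x - y|).
move: (`|x - y|) => z h1 h2; rewrite ler_norml.
case: (leP l x) => ?; case: (leP l y) => ?; case: (leP 0 x) => ?;
  case: (leP 0 y) => ?; rewrite ?(max_r l0); apply/andP; split; lra.
Qed.

Lemma lebesgue_measure_itv_fin (R : realType) (x y : bool) (a b : R) :
  (@lebesgue_measure R [set` Interval (BSide x a) (BSide y b)] < +oo)%E.
Proof. by rewrite lebesgue_measure_itv; case: ifP => _; rewrite ?ltry. Qed.

Lemma Rintegral_cst_itv (R : realType) (x y : bool) (a b c : R) : a <= b ->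
  \int[@lebesgue_measure R]_(t in [set` Interval (BSide x a) (BSide y b)]) c
  = c * (b - a).
Proof.
move=> ab; rewrite Rintegral_cst //; congr (_ * _).
have := lebesgue_measure_itv (Interval (BSide x a) (BSide y b)).
move=> /(congr1 fine) /= ->; rewrite lte_fin.
move: ab; rewrite le_eqVlt => /orP[/eqP ->|->] //=.
by rewrite ltxx subrr.
Qed.

Section cumulant.
Context (R : realType) (alpha beta : R) (pi : {measure set R -> \bar R}).
Context (hPhi : is_branching_triple alpha beta pi) (halpha : 0 < alpha).
Let Phi := branching_mechanism alpha beta pi.
Context (v : R -> R -> R) (hv : is_cumulant Phi v).
Local Notation leb := (@lebesgue_measure R).

Let Phi_ge0 l : 0 <= l -> 0 <= Phi l.
Proof.
move=> l0; apply: le_trans (branching_mechanism_ge hPhi l0).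
by rewrite mulr_ge0 // ltW.
Qed.

Lemma cumulant_le t l : 0 <= t -> 0 <= l -> v t l <= l.
Proof.
move=> t0 l0; rewrite (cumulant_eq hv) // gerBl.
apply: Rintegral_ge0 => s; rewrite /= in_itv /= => /andP[s0 _].
by apply: Phi_ge0; exact: (cumulant_ge0 hv).
Qed.

Lemma cumulant0 l : 0 <= l -> v 0 l = l.
Proof.
by move=> l0; rewrite (cumulant_eq hv) // set_itv1 Rintegral_set1 subr0.
Qed.

Section fixed_argument.
Context (l L : R) (l0 : 0 <= l) (L0 : 0 <= L).
Context (lip : forall a b, 0 <= a <= l -> 0 <= b <= l ->
  `|Phi a - Phi b| <= L * `|a - b|).

(** [Phi] is controlled on [[0, l]], where [v] takes its values. Truncating the argument gives a
    function continuous on the whole line, hence Borel, that agrees with [Phi] along [v]. *)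
Let clamp (u : R) := Num.max 0 (Num.min l u).

Let clampP u : 0 <= clamp u <= l.
Proof.
by rewrite /clamp le_max lexx ge_max l0 ge_min lexx.
Qed.

Let clamp_id u : 0 <= u <= l -> clamp u = u.
Proof.
by move=> /andP[u0 ul]; rewrite /clamp (min_r ul) (max_r u0).
Qed.

Let cont_Phi_clamp : continuous (Phi \o clamp).
Proof.
apply: (@lipschitz_continuous _ _ L) => x y /=.
by apply: (le_trans (lip _ _)) => //; apply: ler_wpM2l => //; exact: clamp_lip.
Qed.

Let v_in s : 0 <= s -> 0 <= v s l <= l.
Proof. by move=> s0; rewrite cumulant_le // (cumulant_ge0 hv). Qed.

Let Phi0 : Phi 0 = 0.
Proof.
rewrite /Phi /branching_mechanism mulr0 expr0n mulr0 !add0r.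
rewrite (_ : Rintegral _ _ _ = \int[pi]_(theta in `]0, +oo[) (0 : R)).
  by rewrite Rintegral_cst // mul0r.
by apply: eq_Rintegral => t _; rewrite oppr0 !mul0r expR0 subrr addr0.
Qed.

Let Phi_le u : 0 <= u <= l -> `|Phi u| <= L * l.
Proof.
move=> /andP[u0 ul]; have := lip (a := u) (b := 0).
rewrite Phi0 !subr0 lexx l0 u0 ul => /(_ isT isT) h.
by apply: (le_trans h); apply: ler_wpM2l => //; rewrite ger0_norm.
Qed.

Lemma measurable_branching_cumulant a b : 0 <= a ->
  measurable_fun (`[a, b]%classic : set R) (fun s => Phi (v s l)).
Proof.
move=> a0; apply: (@eq_measurable_fun _ _ _ _ _ (fun s => (Phi \o clamp) (v s l))).
  move=> s; rewrite inE /= in_itv /= => /andP[sa _].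
  by rewrite /= clamp_id // v_in // (le_trans a0).
apply: (measurableT_comp (continuous_measurable_fun cont_Phi_clamp)).
apply: measurable_funS (cumulant_measurable hv l0) => //.
by move=> s; rewrite /= !in_itv /= andbT => /andP[sa _]; exact: le_trans sa.
Qed.

Lemma integrable_branching_cumulant a b : 0 <= a ->
  leb.-integrable `[a, b]%classic (EFin \o (fun s => Phi (v s l))).
Proof.
move=> a0; apply: measurable_bounded_integrable => //.
- exact: lebesgue_measure_itv_fin.
- exact: measurable_branching_cumulant.
- exists (L * l); split; first exact: num_real.
  move=> M LM s; rewrite /= in_itv /= => /andP[sa _].
  apply: le_trans (ltW LM); apply: Phi_le; apply: v_in.
  exact: le_trans sa.
Qed.

Lemma cumulant_lip (s t : R) : 0 <= s -> s <= t -> `|v s l - v t l| <= L * l * (t - s).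
Proof.
move=> s0 st; have t0 := le_trans s0 st.
rewrite (cumulant_eq hv t0) // (cumulant_eq hv s0) //.
rewrite opprB addrC addrA subrK addrC.
have [<-|st'] := eqVneq s t; first by rewrite addNr subrr normr0 mulr0.
have ij : leb.-integrable `]s, t]%classic (EFin \o (fun s => Phi (v s l))).
  apply: integrableS (integrable_branching_cumulant t s0) => //.
  by move=> u; rewrite /= !in_itv /= => /andP[/ltW -> ->].
rewrite [X in `|X|]addrC Rintegral_itvB //; last first.
  exact: (integrable_branching_cumulant _ (lexx 0)).
apply: (le_trans (le_normr_Rintegral _ ij)) => //.
have -> : L * l * (t - s) = \int[leb]_(x in `]s, t]) (L * l).
  by rewrite Rintegral_cst_itv.
apply: le_Rintegral => //.
- exact: (integrable_norm ij).
- apply: measurable_bounded_integrable => //.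
    exact: lebesgue_measure_itv_fin.
  exists (L * l); split; first exact: num_real.
  by move=> M LM u _; rewrite /= ger0_norm ?mulr_ge0 // ltW.
- move=> u; rewrite /= in_itv /= => /andP[su _].
  by apply: Phi_le; apply: v_in; lra.
Qed.

(** The error is the integral of [Phi l - Phi (v s l)]. One factor [L] comes from [Phi], the other
    from the Lipschitz dependence of [v] on time. *)
Lemma cumulant_small_time (h : R) : 0 <= h ->
  `|v h l - l + h * Phi l| <= L ^+ 2 * l * h ^+ 2.
Proof.
move=> h0; rewrite (cumulant_eq hv) //.
have [<-|h0'] := eqVneq 0 h.
  by rewrite set_itv1 Rintegral_set1 mul0r subr0 subrr addr0 normr0 expr0n mulr0.
have hh : 0 < h by rewrite lt_neqAle h0'.
have cstE (c : R) : \int[leb]_(x in `[0, h]) c = c * h.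
  by rewrite Rintegral_cst_itv // subr0.
have icst (c : R) : leb.-integrable `[0, h]%classic (EFin \o (fun _ => c)).
  apply: measurable_bounded_integrable => //.
    exact: lebesgue_measure_itv_fin.
  exists `|c|; split; first exact: num_real.
  by move=> M LM u _ /=; exact: ltW.
have -> : l - \int[leb]_(s in `[0, h]) Phi (v s l) - l + h * Phi l =
    \int[leb]_(s in `[0, h]) (Phi l - Phi (v s l)).
  rewrite RintegralB //; first by rewrite cstE; ring.
  exact: integrable_branching_cumulant.
have ij : leb.-integrable `[0, h]%classic (EFin \o (fun s => Phi l - Phi (v s l))).
  by apply: integrableBr => //; exact: integrable_branching_cumulant.
apply: (le_trans (le_normr_Rintegral _ ij)) => //.
have -> : L ^+ 2 * l * h ^+ 2 = \int[leb]_(x in `[0, h]) (L ^+ 2 * l * h).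
  by rewrite cstE; ring.
apply: le_Rintegral => //; first exact: (integrable_norm ij).
move=> u; rewrite /= in_itv /= => /andP[u0 uh].
have ll : 0 <= l <= l by rewrite l0 lexx.
apply: (le_trans (lip ll (v_in u0))).
have := cumulant_lip (lexx 0) u0; rewrite cumulant0 // subr0 => H.
rewrite expr2 -!mulrA; apply: ler_wpM2l => //; apply: (le_trans H).
by rewrite mulrA; apply: ler_wpM2l => //; rewrite mulr_ge0.
Qed.

(** For [t >= 0] the cumulant is [l - F t]; the fundamental theorem of calculus is applied to this
    integral form. *)
Let F (t : R) := \int[leb]_(s in `[0, t]) Phi (v s l).

Let F_derive (t : R) : 0 < t -> is_derive t 1 F (Phi (v t l)).
Proof.
move=> t0.
have c0 : 0 < L * (L * l) + 1 by rewrite ltr_wpDl // !mulr_ge0.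
have ct : {for t, continuous (fun s => Phi (v s l))}.
  apply/cvgrPdist_le => e e0; near=> s.
  have s0 : 0 <= s by apply: ltW; near: s; exact: lt_nbhsr.
  have H : `|v t l - v s l| <= L * l * `|t - s|.
    have [ts|st] := leP t s.
      by rewrite (distrC t s) (ger0_norm (x := s - t)) ?subr_ge0 // cumulant_lip // ltW.
    rewrite distrC (gtr0_norm (x := t - s)) ?subr_gt0 //.
    by rewrite cumulant_lip // ltW.
  apply: (le_trans (lip (v_in (ltW t0)) (v_in s0))).
  apply: (@le_trans _ _ (L * (L * l) * `|t - s|)).
    by rewrite -mulrA; exact: ler_wpM2l.
  apply: (@le_trans _ _ ((L * (L * l) + 1) * `|t - s|)).
    by apply: ler_wpM2r => //; lra.
  rewrite mulrC -ler_pdivlMr //; near: s; apply: cvgr_dist_le => //.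
  by rewrite divr_gt0.
have ti : t < t + 1 by lra.
have [d1 d2] := continuous_FTC1_closed ti (integrable_branching_cumulant _ (lexx 0)) t0 ct.
by apply: DeriveDef; [exact: d1|rewrite -derive1E; exact: d2].
Unshelve. all: by end_near. Qed.

(** Integrating factor: [v t l * expR (c * t)] is monotone according to the sign of [c * u - Phi u].
    The choice [c = alpha] gives the upper bound on [v], a slightly larger [c] the lower one. *)
Let G (c t : R) := (l - F t) * expR (c * t).

Let G_derive (c t : R) : 0 < t ->
  is_derive t 1 (G c) ((c * v t l - Phi (v t l)) * expR (c * t)).
Proof.
move=> t0; have FD := F_derive t0.
have E : is_derive t 1 (fun t => expR (c * t)) (c * expR (c * t)).
  apply: is_derive_eq.
  by rewrite /= mulrC /GRing.scale /= mulr1.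
have S : is_derive t 1 (fun t => l - F t) (- Phi (v t l)).
  by rewrite -sub0r; exact: (is_deriveB (is_derive_cst l t 1) FD).
have SE := is_deriveM S E.
suff -> : (c * v t l - Phi (v t l)) * expR (c * t) =
  (l - F t) *: (c * expR (c * t)) + expR (c * t) *: - Phi (v t l) by exact: SE.
have -> : l - F t = v t l by rewrite (cumulant_eq hv (ltW t0)).
by rewrite /GRing.scale /=; ring.
Qed.

Let G_cont (c T : R) : 0 <= T -> {within `[0, T], continuous (G c)}.
Proof.
move=> T0; have Fc := parameterized_integral_continuous T0
  (integrable_branching_cumulant T (lexx 0)).
move=> x; apply: cvgM.
  apply: cvgB; first exact: cvg_cst.
  exact: Fc.
have : continuous (fun t => expR (c * t)).
  move=> y; apply: (@continuous_comp _ _ _ (fun t => c * t) expR).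
    exact: mulrl_continuous.
  exact: continuous_expR.
by move=> /continuous_subspaceT; exact.
Qed.

Let GE (c t : R) : 0 <= t -> G c t = v t l * expR (c * t).
Proof. by move=> t0; rewrite /G (cumulant_eq hv t0). Qed.

Lemma cumulant_le_expR (t : R) : 0 <= t -> v t l <= l * expR (- (alpha * t)).
Proof.
move=> t0; rewrite expRN ler_pdivlMr ?expR_gt0 // -GE //.
have <- : G alpha 0 = l by rewrite GE // mulr0 expR0 mulr1 cumulant0.
apply: (@ler0_derive1_nincr _ _ 0 t) => //.
- move=> x; rewrite in_itv /= => /andP[x0 _].
  by case: (G_derive alpha x0).
- move=> x; rewrite in_itv /= => /andP[x0 _].
  rewrite derive1E (@derive_val _ _ _ _ _ _ _ (G_derive alpha x0)).
  rewrite pmulr_lle0 ?expR_gt0 // subr_le0.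
  by apply: branching_mechanism_ge => //; exact: (cumulant_ge0 hv (ltW x0)).
- exact: G_cont.
Qed.

Lemma cumulant_ge_expR (c t : R) : 0 <= t ->
  (forall u, 0 <= u <= l -> Phi u <= c * u) -> l * expR (- (c * t)) <= v t l.
Proof.
move=> t0 Pc; rewrite expRN ler_pdivrMr ?expR_gt0 // -GE //.
have <- : G c 0 = l by rewrite GE // mulr0 expR0 mulr1 cumulant0.
apply: (@ger0_derive1_ndecr _ _ 0 t) => //.
- move=> x; rewrite in_itv /= => /andP[x0 _].
  by case: (G_derive c x0).
- move=> x; rewrite in_itv /= => /andP[x0 _].
  rewrite derive1E (@derive_val _ _ _ _ _ _ _ (G_derive c x0)).
  rewrite pmulr_lge0 ?expR_gt0 // subr_ge0.
  by apply: Pc; apply: v_in; exact: ltW.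
- exact: G_cont.
Qed.

End fixed_argument.

End cumulant.

(* The polynomial approximates [u |-> c u / (1 - u) ^+ 2], where [c] is a
   Lipschitz cutoff between the two thresholds; with [u = expR (- z)] the
   thresholds read [z > r2] and [z > r1]. *)
Lemma threshold_poly (R : realType) (r1 r2 K e : R) :
  0 < r1 -> r1 < r2 -> 0 <= K -> 0 < e ->
  exists p : {poly R}, `|p.[1]| <= e /\ forall u, 0 <= u <= expR K ->
    (u < expR (- r2))%R%:R - e * (1 - u) ^+ 2 <= p.[u] * (1 - u) ^+ 2
      <= (u < expR (- r1))%R%:R + e * (1 - u) ^+ 2.
Proof.
move=> r10 r12 K0 e0.
pose a := expR (- r2); pose b := expR (- r1).
have ab : a < b by rewrite ltr_expR ltrN2.
have a0 : 0 < a by exact: expR_gt0.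
have b0 : 0 < b by exact: expR_gt0.
have b1 : b < 1 by rewrite -expR0 ltr_expR oppr_lt0.
have ba0 : 0 < b - a by rewrite subr_gt0.
pose c (u : R) := Num.max 0 (Num.min 1 ((b - u) / (b - a))).
(* Freezing [1 - u] at its value in [b] removes the pole at [u = 1]. Nothing changes in the
   quotient, since the cutoff [c] vanishes beyond [b]. *)
pose m (u : R) := Num.max (1 - u) (1 - b).
pose g (u : R) := c u * (m u ^+ 2)^-1.
pose k := 1 - b.
have k0 : 0 < k by rewrite subr_gt0.
have mk u : k <= m u by rewrite le_max lexx orbT.
have m0 u : 0 < m u by exact: lt_le_trans k0 (mk u).
have m1 u : 0 <= u -> m u <= 1 by move=> u0; rewrite ge_max; apply/andP; split; lra.
have c01 u : 0 <= c u <= 1 by rewrite le_max lexx ge_max ler01 ge_min lexx.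
have cl u v : `|c u - c v| <= (b - a)^-1 * `|u - v|.
  apply: (le_trans (clamp_lip _ _ ler01)).
  have -> : (b - u) / (b - a) - (b - v) / (b - a) = (b - a)^-1 * (v - u).
    by field; lra.
  by rewrite normrM gtr0_norm ?invr_gt0 // distrC.
have ml u v : `|m u - m v| <= `|u - v|.
  have := ler_norm (u - v); have := lerNnormlW (lexx `|u - v|).
  move: (`|u - v|) => z h1 h2; rewrite ler_norml /m.
  by case: (leP (1 - u)) => ?; case: (leP (1 - v)) => ?; apply/andP; split; lra.
have wk u : (m u ^+ 2)^-1 <= (k ^+ 2)^-1.
  by rewrite lef_pV2 ?posrE ?exprn_gt0 // ler_pXn2r // nnegrE ltW.
have wl u v : 0 <= u -> 0 <= v ->
    `|(m u ^+ 2)^-1 - (m v ^+ 2)^-1| <= 2 * (k ^+ 2)^-1 * (k ^+ 2)^-1 * `|u - v|.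
  move=> u0 v0.
  have -> : (m u ^+ 2)^-1 - (m v ^+ 2)^-1 =
      (m u + m v) * (m u ^+ 2)^-1 * (m v ^+ 2)^-1 * (m v - m u).
    have := m0 u; have := m0 v; move: (m u) (m v) => x y y0 x0.
    by field; rewrite !gt_eqF.
  have s0 : 0 <= (m u + m v) * (m u ^+ 2)^-1 * (m v ^+ 2)^-1.
    by rewrite !mulr_ge0 ?invr_ge0 ?sqr_ge0 // addr_ge0 // ltW.
  rewrite normrM (ger0_norm s0) distrC; apply: ler_pM => //.
  apply: ler_pM => //; rewrite ?invr_ge0 ?sqr_ge0 //.
    by rewrite mulr_ge0 ?invr_ge0 ?sqr_ge0 // addr_ge0 // ltW.
  apply: ler_pM => //; rewrite ?invr_ge0 ?sqr_ge0 // ?addr_ge0 ?(ltW (m0 _)) //.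
  have := m1 u u0; have := m1 v v0; lra.
pose L := (b - a)^-1 * (k ^+ 2)^-1 + 2 * (k ^+ 2)^-1 * (k ^+ 2)^-1.
have kk0 : 0 <= (k ^+ 2)^-1 by rewrite invr_ge0 sqr_ge0.
have L0 : 0 <= L by rewrite addr_ge0 // !mulr_ge0 // invr_ge0 ltW.
have gl u v : 0 <= u -> 0 <= v -> `|g u - g v| <= L * `|u - v|.
  move=> u0 v0; rewrite /g.
  have -> : c u * (m u ^+ 2)^-1 - c v * (m v ^+ 2)^-1 =
    (c u - c v) * (m u ^+ 2)^-1 + c v * ((m u ^+ 2)^-1 - (m v ^+ 2)^-1) by ring.
  rewrite /L [leRHS]mulrDl; apply: (le_trans (ler_normD _ _)); apply: lerD.
    rewrite normrM mulrAC; apply: ler_pM => //.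
    by rewrite ger0_norm // invr_ge0 sqr_ge0.
  rewrite normrM -[leRHS]mul1r; apply: ler_pM => //; last exact: wl.
  by have /andP[h1 h2] := c01 v; rewrite ger0_norm.
have eK0 : 0 < expR K by exact: expR_gt0.
have [p Hp] := lipschitz_poly_approx eK0 L0 e0 gl.
have cb u : b <= u -> c u = 0.
  move=> bu; rewrite /c; apply/max_idPl; rewrite ge_min; apply/orP; right.
  by rewrite pmulr_lle0 ?invr_gt0 // subr_le0.
have mb u : u <= b -> m u = 1 - u.
  by move=> ub; rewrite /m; apply/max_idPl; lra.
have ca u : u < a -> c u = 1.
  move=> ua; rewrite /c (@min_l _ _ 1) ?(@max_r _ _ 0) //.
  by rewrite ler_pdivlMr // mul1r; lra.
(* The value at [u = 1] will multiply [2 * beta]; it is small because the cutoff vanishes there. *)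
exists p; split.
  have := Hp 1; rewrite ler01 -expR0 ler_expR K0 => /(_ isT).
  by rewrite expR0 /g cb ?(ltW b1) // mul0r subr0.
move=> u uK; have /andP[u0 _] := uK.
have := Hp u uK.
rewrite ler_distl => /andP[h1 h2].
have s0 : 0 <= (1 - u) ^+ 2 by exact: sqr_ge0.
have {}h1 : (g u - e) * (1 - u) ^+ 2 <= p.[u] * (1 - u) ^+ 2 by exact: ler_wpM2r.
have {}h2 : p.[u] * (1 - u) ^+ 2 <= (g u + e) * (1 - u) ^+ 2 by exact: ler_wpM2r.
rewrite -/a -/b.
have [ub|bu] := ltP u b; last first.
  have -> : u < a = false by apply/negbTE; rewrite -leNgt; lra.
  by move: h1 h2; rewrite /g cb // mul0r sub0r add0r mulNr /=; lra.
have q : g u * (1 - u) ^+ 2 = c u.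
  by rewrite /g mb ?(ltW ub) // divfK // sqrf_eq0 subr_eq0; lra.
have /andP[c0 c1] := c01 u.
move: h1 h2; rewrite mulrBl mulrDl q.
have [ua|au] /= := ltP u a; last by lra.
by rewrite ca //; lra.
Qed.

(** * Bounds for polynomials, staircases and meshes *)

Lemma horner_bounded (R : realType) (p : {poly R}) (M : R) :
  exists2 B, 0 <= B & forall u, 0 <= u <= M -> `|p.[u]| <= B.
Proof.
elim/poly_ind: p => [|p c [B B0 HB]].
  by exists 0 => // u _; rewrite horner0 normr0.
have [M0|M0] := leP 0 M; last first.
  by exists 0 => // u /andP[u0 uM]; have := lt_le_trans M0 (le_trans u0 uM); rewrite ltxx.
exists (B * M + `|c|); first by rewrite addr_ge0 // mulr_ge0.
move=> u uM; have /andP[u0 uM'] := uM.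
rewrite hornerMXaddC; apply: (le_trans (ler_normD _ _)); rewrite lerD2r normrM.
by apply: ler_pM => //; [exact: HB|rewrite ger0_norm].
Qed.

Lemma measurable_horner (R : realType) (p : {poly R}) : measurable_fun setT (fun u : R => p.[u]).
Proof.
elim/poly_ind: p => [|p c IH].
  by apply: (eq_measurable_fun (fun _ : R => 0 : R)) => // u _; rewrite horner0.
apply: (eq_measurable_fun (fun u => p.[u] * u + c)).
  by move=> u _; rewrite hornerMXaddC.
by apply: measurable_funD => //; exact: measurable_funM.
Qed.

Lemma staircase_bounds (R : realType) (e z : R) : 0 < e -> 0 <= z ->
  (z%:E <= \big[+%E/0%E]_(0 <= j <oo) (e * (\1_[set u : R | j%:R * e <= u] z))%:E
        <= (z + e)%:E)%E.
Proof.
move=> e0 z0.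
pose f j := (e * (\1_[set u : R | j%:R * e <= u] z)) : R.
have f0 j : 0 <= f j by rewrite mulr_ge0 // ltW.
(* Partial sums stay between two truncations at [n * e]; the upper one has [z + e] because the
   multiple [0] is counted too. *)
have H n : Num.min z (n%:R * e) <= \sum_(0 <= j < n) f j <= Num.min (z + e) (n%:R * e).
  elim: n => [|n /andP[h1 h2]].
    by rewrite big_nil mul0r; apply/andP; split; rewrite ?ge_min ?le_min ?lexx ?orbT //=; lra.
  rewrite big_nat_recr //= -natr1 mulrDl mul1r.
  have [nz|nz] := leP (n%:R * e) z.
    have -> : f n = e by rewrite /f indicE mem_set // mulr1.
    move: h1 h2; rewrite (min_r nz) ge_min !le_min => h1 /andP[_ h2].
    by apply/andP; split; [apply/orP; right|apply/andP; split]; lra.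
  have -> : f n = 0.
    by rewrite /f indicE memNset ?mulr0 //=; apply/negP; rewrite -ltNge.
  move: h1 h2; rewrite addr0 (min_l (ltW nz)) ge_min !le_min.
  by move=> -> /andP[-> h2] /=; lra.
apply/andP; split.
- pose n := Num.bound (z / e).
  have zn : z <= n%:R * e.
    by rewrite -ler_pdivrMr // ltW // archi_boundP // divr_ge0 // ltW.
  have := H n; rewrite (min_l zn) => /andP[h _].
  apply: (@le_trans _ _ (\sum_(0 <= j < n) (f j)%:E)%E).
    by rewrite sumEFin lee_fin.
  by apply: nneseries_lim_ge => k _ _; rewrite lee_fin.
- apply: lime_le; first by apply: is_cvg_nneseries => k _ _; rewrite lee_fin; exact: f0.
  apply: nearW => n; rewrite sumEFin lee_fin.
  by have /andP[_] := H n; rewrite le_min => /andP[].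
Qed.

Lemma small_step (R : realType) (T a : R) : 0 < T -> 0 < a ->
  exists N0, forall N, (N0 <= N)%N -> T / N.+1%:R <= a.
Proof.
move=> T0 a0; exists (Num.bound (T / a)) => N N0N.
rewrite ler_pdivrMr // mulrC -ler_pdivrMr //.
apply: (@le_trans _ _ (Num.bound (T / a))%:R).
  by apply: ltW; apply: archi_boundP; rewrite divr_ge0 // ltW.
by rewrite ler_nat; exact: leqW.
Qed.

(** * Mean and martingale property *)

Section process.
Context (R : realType) (alpha beta : R) (pi : {measure set R -> \bar R}).
Context (hPhi : is_branching_triple alpha beta pi) (halpha : 0 < alpha).
Let Phi := branching_mechanism alpha beta pi.
Context (d : measure_display) (Omega : measurableType d).
Context (X : R -> Omega -> R) (P : R -> probability Omega R).
Context (hX : is_CB_process Phi X P).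

Let hM := CB_markov hX.

Lemma measurable_process (t : R) (D : set Omega) : 0 <= t -> measurable_fun D (X t).
Proof. by move=> t0; apply: measurable_funTS; exact: (markov_measurable hM). Qed.

Lemma bounded_integrable (y : R) (C : set Omega) (f : Omega -> R) (M : R) :
  measurable C -> measurable_fun C f -> (forall w, `|f w| <= M) ->
  (P y).-integrable C (EFin \o f).
Proof.
move=> mC mf fM; apply: measurable_bounded_integrable => //.
  by apply: le_lt_trans (probability_le1 _ mC) _; rewrite ltry.
exists M; split; first exact: num_real.
by move=> M' MM' w _; apply: le_trans (ltW MM'); exact: fM.
Qed.

Lemma Rintegral_probability_cst (y c : R) : \int[P y]_w c = c.
Proof.
rewrite Rintegral_cst // [X in fine X](_ : _ = 1%E) ?mulr1 //.
exact: probability_setT.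
Qed.

Lemma laplace_Rintegral (y t l : R) (v : R -> R -> R) :
  (forall x t lambda : R, 0 <= x -> 0 <= t -> 0 <= lambda ->
      ('E_(P x)[fun w => expR (- lambda * X t w)]
       = (expR (- x * v t lambda))%:E)%E) ->
  0 <= y -> 0 <= t -> 0 <= l ->
  \int[P y]_w expR (- l * X t w) = expR (- y * v t l).
Proof.
by move=> LT y0 t0 l0; have := LT y t l y0 t0 l0; rewrite unlock /Rintegral => ->.
Qed.

(** The Laplace transform is differentiated at [0] through the quotients [g n], which lie below
    [X t] and converge to it. The exponential bounds on the cumulant then give the two
    inequalities. *)
Lemma mean_process (y t : R) : 0 <= y -> 0 <= t ->
  (\int[P y]_w (X t w)%:E = (y * expR (- (alpha * t)))%:E)%E.
Proof.
move=> y0 t0; have [v hv LT] := CB_laplace hX.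
pose l (n : nat) : R := n.+1%:R^-1.
have l_gt0 n : 0 < l n by rewrite invr_gt0.
have l_ge0 n : 0 <= l n by exact: ltW.
pose g (n : nat) (w : Omega) : R := (l n)^-1 * (1 - expR (- l n * X t w)).
have Xge0 w : 0 <= X t w by exact: (markov_ge0 hM).
have g_ge0 n w : 0 <= g n w.
  rewrite mulr_ge0 ?invr_ge0 // subr_ge0 mulNr.
  by apply: expRN_le1; rewrite mulr_ge0.
have g_le n w : g n w <= X t w.
  rewrite /g mulrC ler_pdivrMr // mulNr mulrC.
  by have := expRN_ge (X t w * l n); lra.
have g_ge n w : X t w - X t w ^+ 2 * l n <= g n w.
  rewrite /g [leRHS]mulrC ler_pdivlMr // mulNr.
  have := expRN_le_sqr (mulr_ge0 (l_ge0 n) (Xge0 w)).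
  by rewrite exprMn !expr2; lra.
have mg n : measurable_fun setT (g n).
  apply: measurable_funM => //; apply: measurable_funB => //.
  apply: measurableT_comp => //; apply: measurable_funM => //.
  exact: measurable_process.
have mX : measurable_fun setT (X t) by exact: measurable_process.
have intg n : (\int[P y]_w (g n w)%:E =
    ((l n)^-1 * (1 - expR (- y * v t (l n))))%:E)%E.
  have i1 : (P y).-integrable setT (EFin \o (fun w => expR (- l n * X t w))).
    apply: (@bounded_integrable _ _ _ 1) => //.
      by apply: measurableT_comp => //; apply: measurable_funM.
    move=> w; rewrite ger0_norm ?expR_ge0 // mulNr.
    by apply: expRN_le1; rewrite mulr_ge0.
  have ic : (P y).-integrable setT (EFin \o (fun=> 1 : R)).
    by apply: (@bounded_integrable _ _ _ 1) => // w; rewrite normr1.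
  rewrite -(laplace_Rintegral LT) //.
  rewrite -[X in X - Rintegral _ _ _](Rintegral_probability_cst y).
  rewrite -RintegralB // -RintegralZl //; last exact: integrableBr.
  rewrite /Rintegral fineK //.
  apply: integrable_fin_num => //.
  by apply: integrableZlr => //; exact: integrableBr.
have up n : (l n)^-1 * (1 - expR (- y * v t (l n))) <= y * expR (- (alpha * t)).
  have vn := cumulant_ge0 hv t0 (l_ge0 n).
  have [L L0 lip] := branching_mechanism_lip hPhi (l_ge0 n).
  have := cumulant_le_expR hPhi halpha hv (l_ge0 n) L0 lip t0.
  have := expRN_ge (y * v t (l n)); rewrite mulNr => h1 h2.
  rewrite mulrC ler_pdivrMr //; apply: (@le_trans _ _ (y * v t (l n))); first by lra.
  by rewrite -mulrA; apply: ler_wpM2l => //; rewrite mulrC.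
(* Fatou's lemma yields the upper bound and, with it, the finiteness that the lower bound
   presupposes. *)
have EX_le : (\int[P y]_w (X t w)%:E <= (y * expR (- (alpha * t)))%:E)%E.
  have F := @fatou _ _ _ (P y) _ measurableT (fun n w => (g n w)%:E).
  have {F} : (\int[P y]_w limn_einf (fun n => (g n w)%:E) <=
       limn_einf (fun n => \int[P y]_w (g n w)%:E))%E.
    apply: F => //; first by move=> n; exact/measurable_EFinP.
    by move=> n w _; rewrite lee_fin.
  under eq_integral.
    move=> w _.
    have cw : (g n w)%:E @[n --> \oo] --> (X t w)%:E.
      apply/cvg_EFin; first exact: nearW.
      apply: (@squeeze_cvgr _ _ _ _ (fun n => X t w - X t w ^+ 2 * l n) (cst (X t w))).
      - by apply: nearW => n; rewrite g_le g_ge.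
      - rewrite -[X in _ --> X]subr0 -(mulr0 (X t w ^+ 2)); apply: cvgB.
          exact: cvg_cst.
        by apply: cvgMl_tmp; exact: cvg_harmonic.
      - exact: cvg_cst.
    rewrite (cvg_limn_einf_sup cw).
    over.
  move=> /le_trans; apply.
  apply: (le_trans (limn_einf_sup _)); rewrite limn_esup_lim.
  apply: lime_le; first exact: is_cvg_esups.
  apply: nearW => n; rewrite /esups /sdrop; apply: ge_ereal_sup => _ [m _ <-].
  by rewrite intg lee_fin.
have EX_ge0 : (0 <= \int[P y]_w (X t w)%:E)%E.
  by apply: integral_ge0 => w _; rewrite lee_fin.
have EX_fin : (\int[P y]_w (X t w)%:E)%E \is a fin_num.
  by rewrite ge0_fin_numE //; apply: (le_lt_trans EX_le); rewrite ltry.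
apply/eqP; rewrite eq_le EX_le /= -(fineK EX_fin) lee_fin.
set m := fine _.
have low n : (l n)^-1 * (1 - expR (- y * v t (l n))) <= m.
  rewrite -lee_fin -intg /m fineK //; apply: ge0_le_integral => //.
  - by move=> w _; rewrite lee_fin.
  - exact/measurable_EFinP.
  - exact/measurable_EFinP.
  - by move=> w _; rewrite lee_fin.
apply/ler_addgt0Pr => e e0.
set A := y * expR (- (alpha * t)).
have A0 : 0 <= A by rewrite mulr_ge0 // expR_ge0.
(* Two errors of at most [e / 2]: one from replacing [alpha] by [alpha + e1] as slope of [Phi] near
   [0], the other, [y ^+ 2 * l n], from expanding the exponential. *)
pose e1 := e / (2 * (A * t + 1)).
have At : 0 <= A * t by rewrite mulr_ge0.
have e10 : 0 < e1 by rewrite divr_gt0 // mulr_gt0 //; lra.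
have e1P : A * t * e1 <= e / 2.
  have -> : e / 2 = (A * t + 1) * e1 by rewrite /e1; field; lra.
  by rewrite ler_pM2r //; lra.
have [l0 l00 Pl] := branching_mechanism_small hPhi e10.
pose d0 := Num.min l0 (e / (2 * (y ^+ 2 + 1))).
have y2 : 0 <= y ^+ 2 by exact: sqr_ge0.
have d00 : 0 < d0.
  by rewrite lt_min l00 divr_gt0 // mulr_gt0 //; lra.
have [n _ /(_ n (leqnn _)) /= ln] := near_infty_natSinv_lt (PosNum d00).
rewrite -/(l n) lt_min in ln; have /andP[ln0 lne] := ln.
have ye : y ^+ 2 * l n <= e / 2.
  have -> : e / 2 = (y ^+ 2 + 1) * (e / (2 * (y ^+ 2 + 1))) by field; lra.
  by apply: ler_pM => //; [lra|exact: ltW].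
have [L L0 lip] := branching_mechanism_lip hPhi (l_ge0 n).
have vlow : l n * expR (- ((alpha + e1) * t)) <= v t (l n).
  apply: (cumulant_ge_expR hPhi halpha hv (l_ge0 n) L0 lip t0).
  by move=> u /andP[u0 ul]; apply: Pl; rewrite u0 /=; lra.
have vn := cumulant_ge0 hv t0 (l_ge0 n).
have vl := cumulant_le hPhi halpha hv t0 (l_ge0 n).
have yv0 : 0 <= y * v t (l n) by rewrite mulr_ge0.
suff : A - A * t * e1 - y ^+ 2 * l n <= m by lra.
apply: le_trans (low n); rewrite [leRHS]mulrC ler_pdivlMr //.
have h1 := expRN_le_sqr yv0.
have h2 : A * (1 - t * e1) * l n <= y * v t (l n).
  apply: (@le_trans _ _ (y * (l n * expR (- ((alpha + e1) * t))))); last first.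
    exact: ler_wpM2l.
  have -> : - ((alpha + e1) * t) = - (alpha * t) + - (t * e1) by ring.
  rewrite expRD /A.
  have -> : y * (l n * (expR (- (alpha * t)) * expR (- (t * e1)))) =
    y * expR (- (alpha * t)) * expR (- (t * e1)) * l n by ring.
  by apply: ler_wpM2r => //; apply: ler_wpM2l => //; exact: expRN_ge.
have h3 : (y * v t (l n)) ^+ 2 <= y ^+ 2 * l n * l n.
  rewrite exprMn -mulrA; apply: ler_wpM2l => //; rewrite expr2.
  by apply: ler_pM.
rewrite mulNr; move: h1 h2 h3.
set a := expR _; set b := y * v t _; set c := b ^+ 2.
have -> : A * (1 - t * e1) * l n = (A - A * t * e1) * l n by ring.
move: (A - A * t * e1) (y ^+ 2 * l n) => B C; rewrite mulrBl.
by move: (B * l n) (C * l n) => D E; lra.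
Qed.

Lemma process_integrable (y t : R) (C : set Omega) : 0 <= y -> 0 <= t ->
  measurable C -> (P y).-integrable C (EFin \o X t).
Proof.
move=> y0 t0 mC; apply: (integrableS measurableT mC) => //.
apply/integrableP; split.
  by apply/measurable_EFinP; exact: measurable_process.
under eq_integral do rewrite /= ger0_norm ?(markov_ge0 hM) //.
by rewrite mean_process // ltry.
Qed.

Lemma mean_process_Rintegral (y t : R) : 0 <= y -> 0 <= t ->
  \int[P y]_w X t w = y * expR (- (alpha * t)).
Proof. by move=> y0 t0; rewrite /Rintegral mean_process. Qed.

Let history (t : R) : set (set Omega) :=
  \bigcup_(u in `[0, t]) preimage_set_system setT (X u) measurable.

Lemma filtration_measurable (t : R) (A : set Omega) :
  natural_filtration X t A -> measurable A.
Proof.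
apply: smallest_sub; first exact: sigma_algebra_measurable.
move=> B [u /=]; rewrite in_itv /= => /andP[u0 _] [C mC <-].
by apply: (@measurable_process _ setT u0).
Qed.

Lemma filtration_preimage (t u : R) (B : set R) : 0 <= u -> u <= t ->
  measurable B -> natural_filtration X t (X u @^-1` B).
Proof.
move=> u0 ut mB; apply: sub_gen_smallest; exists u.
  by rewrite /= in_itv /= u0 ut.
by exists B => //; rewrite setTI.
Qed.

Lemma filtrationC (t : R) (A : set Omega) :
  natural_filtration X t A -> natural_filtration X t (~` A).
Proof. exact: (@measurableC _ (g_sigma_algebraType (history t))). Qed.

Lemma filtrationU (t : R) (A B : set Omega) :
  natural_filtration X t A -> natural_filtration X t B ->
  natural_filtration X t (A `|` B).
Proof. exact: (@measurableU _ (g_sigma_algebraType (history t))). Qed.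

Lemma filtrationI (t : R) (A B : set Omega) :
  natural_filtration X t A -> natural_filtration X t B ->
  natural_filtration X t (A `&` B).
Proof. exact: (@measurableI _ (g_sigma_algebraType (history t))). Qed.

Lemma filtrationT (t : R) : natural_filtration X t setT.
Proof. exact: (@measurableT _ (g_sigma_algebraType (history t))). Qed.

Lemma filtration0 (t : R) : natural_filtration X t set0.
Proof. exact: (@measurable0 _ (g_sigma_algebraType (history t))). Qed.

(* Only the inequality is needed, so approximating [X] by the staircase
   [e * (1 + floor (X / e))] from above avoids extending the Markov property
   from events to functions. *)
Lemma supermartingale (y s t : R) (A : set Omega) : 0 <= y -> 0 <= s -> 0 <= t ->
  natural_filtration X s A ->
  expR (- (alpha * t)) * \int[P y]_(w in A) X s w <=
  \int[P y]_(w in A) X (s + t) w.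
Proof.
move=> y0 s0 t0 FA; have mA := filtration_measurable FA.
have st0 : 0 <= s + t by rewrite addr_ge0.
rewrite -RintegralZl //; last exact: process_integrable.
have fin1 : (\int[P y]_(w in A) (X (s + t) w)%:E)%E \is a fin_num.
  by apply: integrable_fin_num => //; exact: process_integrable.
have fin2 : (\int[P y]_(w in A) (expR (- (alpha * t)) * X s w)%:E)%E \is a fin_num.
  by apply: integrable_fin_num => //; apply: integrableZlr => //; exact: process_integrable.
rewrite -lee_fin /Rintegral !fineK //.
apply/lee_addgt0Pr => e e0.
pose B j := [set u : R | j%:R * e <= u].
have mB j : measurable (B j).
  have -> : B j = `[j%:R * e, +oo[%classic.
    by apply/seteqP; split => u; rewrite /B /= in_itv /= andbT.
  exact: measurable_itv.
have mXB j u (D : set Omega) : 0 <= u -> measurable_fun D (fun w => (e * \1_(B j) (X u w))%:E).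
  move=> u0; apply/measurable_EFinP; apply: measurable_funM => //.
  apply: measurableT_comp; first exact: measurable_indic.
  exact: measurable_process.
have tail u z j (D : set Omega) : 0 <= u -> measurable D ->
  (\int[P z]_(w in D) (e * \1_(B j) (X u w))%:E = e%:E * P z (D `&` X u @^-1` B j))%E.
  move=> u0 mD.
  have mXu : measurable (X u @^-1` B j) by rewrite -[X in measurable X]setTI; exact: measurable_process.
  under eq_integral do rewrite EFinM.
  rewrite ge0_integralZl //; last 2 first.
  - apply/measurable_EFinP; apply: measurableT_comp; first exact: measurable_indic.
    exact: measurable_process.
  - by rewrite lee_fin ltW.
  rewrite -(setIC (X u @^-1` B j)) -integral_indic //.
have ge0 j u : (0 <= (e * \1_(B j) u)%:E)%E by rewrite lee_fin mulr_ge0 // ltW.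
have mK j : measurable_fun A (fun w => e%:E * P (X s w) (X t @^-1` B j))%E.
  apply: emeasurable_funM => //.
  apply: (@measurable_comp _ _ _ _ _ _ (`[0, +oo[%classic : set R) (fun z => P z (X t @^-1` B j))) => //.
  - move=> _ [w _ <-]; rewrite /= in_itv /= andbT; exact: (markov_ge0 hM).
  - exact: (markov_kernel hM).
  - exact: measurable_process.
(* By [mean_process] the integrand on the left is the mean of [X t] under [P (X s w)], hence at most
   a sum of level probabilities. The Markov property converts each level into one for [X (s + t)],
   and the levels are then summed back at a cost of at most [e]. *)
apply: (@le_trans _ _ (\int[P y]_(w in A)
   \big[+%E/0%E]_(0 <= j <oo) (e%:E * P (X s w) (X t @^-1` B j)))%E).
  apply: ge0_le_integral => //.
  - by move=> w _; rewrite lee_fin mulr_ge0 ?expR_ge0 // (markov_ge0 hM).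
  - apply/measurable_EFinP; apply: measurable_funM => //; exact: measurable_process.
  - by apply: ge0_emeasurable_sum => // j w _ _; rewrite mule_ge0 // lee_fin ltW.
  - move=> w _; have X0 : 0 <= X s w by exact: (markov_ge0 hM).
    rewrite mulrC -mean_process //.
    under [in leRHS]eq_eseriesr do rewrite -[X in P _ X]setTI -tail //.
    rewrite -integral_nneseries //; last by move=> j; exact: mXB.
    apply: ge0_le_integral => //.
    + by move=> w' _; rewrite lee_fin (markov_ge0 hM).
    + by apply/measurable_EFinP; exact: measurable_process.
    + by apply: ge0_emeasurable_sum => // j *; exact: mXB.
    + by move=> w' _; have /andP[] := staircase_bounds e0 (markov_ge0 hM w' t0).
rewrite integral_nneseries //; last first.
  by move=> j w _; rewrite mule_ge0 // lee_fin ltW.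
have -> : (\big[+%E/0]_(0 <= j <oo) (\int[P y]_(w in A) (e%:E * P (X s w) (X t @^-1` B j))) =
  \big[+%E/0]_(0 <= j <oo) (\int[P y]_(w in A) (e * \1_(B j) (X (s + t) w))%:E))%E.
  apply: eq_eseriesr => j _; rewrite tail // (markov_property hM) //.
  rewrite ge0_integralZl //; last by rewrite lee_fin ltW.
  apply: (@measurable_comp _ _ _ _ _ _ (`[0, +oo[%classic : set R) (fun z => P z (X t @^-1` B j))) => //.
  - move=> _ [w _ <-]; rewrite /= in_itv /= andbT; exact: (markov_ge0 hM).
  - exact: (markov_kernel hM).
  - exact: measurable_process.
rewrite -integral_nneseries //; last by move=> j; exact: mXB.
apply: (@le_trans _ _ (\int[P y]_(w in A) (X (s + t) w + e)%:E)%E).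
  apply: ge0_le_integral => //.
  - by move=> w _; apply: nneseries_ge0.
  - by apply: ge0_emeasurable_sum => // j *; exact: mXB.
  - apply/measurable_EFinP; apply: measurable_funD => //; exact: measurable_process.
  - by move=> w _; have /andP[] := staircase_bounds e0 (markov_ge0 hM w st0).
under [leLHS]eq_integral do rewrite EFinD.
rewrite ge0_integralD //; last 3 first.
- by move=> w _; rewrite lee_fin (markov_ge0 hM).
- by apply/measurable_EFinP; exact: measurable_process.
- by move=> w _; rewrite lee_fin ltW.
rewrite leeD2l // integral_cst // -[leRHS]mule1 lee_pmul2l //.
exact: probability_le1.
Qed.

(** * Small-time asymptotics *)

Let Dpos : set R := `]0, +oo[%classic.
Let mDpos : measurable Dpos.
Proof. exact: measurable_itv. Qed.

(** The transform of the increment is exactly [expR a] with [a = y * (l - v h l)]. Here [a] is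
    [h * y * Phi l] up to order [h^2], and so is [expR a - 1]. *)
Lemma laplace_small_time (K l : R) : 0 <= K -> 0 <= l ->
  exists C h1, [/\ 0 <= C, 0 < h1 & forall h y, 0 <= h <= h1 -> 0 <= y <= K ->
    `|\int[P y]_w expR (- l * (X h w - y)) - 1 - h * y * Phi l| <= C * h ^+ 2].
Proof.
move=> K0 l0; have [v hv LT] := CB_laplace hX.
have [L L0 lip] := branching_mechanism_lip hPhi l0.
have Pl0 : 0 <= Phi l.
  by apply: le_trans (branching_mechanism_ge hPhi l0); rewrite mulr_ge0 // ltW.
pose c := L ^+ 2 * l.
have c0 : 0 <= c by rewrite mulr_ge0 // sqr_ge0.
pose B := K * (Phi l + c).
have B0 : 0 <= B by rewrite mulr_ge0 // addr_ge0.
(* This forces [a <= B * h <= 1 / 2], the range in which [expR a <= 1 + a + 2 * a^2]. *)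
pose h1 := (2 * (B + 1))^-1.
have h10 : 0 < h1 by rewrite invr_gt0; lra.
have h11 : h1 <= 1 by rewrite invf_le1; lra.
have Bh1 : B * h1 <= 1 / 2.
  have -> : 1 / 2 = (B + 1) * h1 by rewrite /h1; field; lra.
  by rewrite ler_pM2r //; lra.
exists (2 * B ^+ 2 + K * c), h1; split => //.
  by rewrite addr_ge0 // mulr_ge0 ?sqr_ge0.
move=> h y /andP[h0 hh] /andP[y0 yK].
have -> : \int[P y]_w expR (- l * (X h w - y)) = expR (y * (l - v h l)).
  have -> : y * (l - v h l) = l * y + (- y * v h l) by ring.
  rewrite expRD -(laplace_Rintegral LT) // -RintegralZl //.
    by apply: eq_Rintegral => w _; rewrite -expRD; congr expR; ring.
  apply: (@bounded_integrable _ _ _ 1) => //.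
    apply: measurableT_comp => //; apply: measurable_funM => //.
    exact: measurable_process.
  move=> w; rewrite ger0_norm ?expR_ge0 // mulNr.
  by apply: expRN_le1; rewrite mulr_ge0 // (markov_ge0 hM).
have vl := cumulant_le hPhi halpha hv h0 l0.
have vs := cumulant_small_time hPhi halpha hv l0 L0 lip h0.
set a := y * (l - v h l).
have a0 : 0 <= a by rewrite mulr_ge0 // subr_ge0.
have hK2 : 0 <= h ^+ 2 by exact: sqr_ge0.
have ah : `|a - h * y * Phi l| <= K * c * h ^+ 2.
  have -> : a - h * y * Phi l = - (y * (v h l - l + h * Phi l)) by rewrite /a; ring.
  rewrite normrN normrM (ger0_norm y0) -mulrA.
  by apply: ler_pM => //.
have aB : a <= B * h.
  have : a <= h * y * Phi l + K * c * h ^+ 2.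
    by move: ah; rewrite ler_norml => /andP[_]; rewrite lerBlDl.
  move=> /le_trans; apply.
  have -> : B * h = h * K * Phi l + K * c * h by rewrite /B; ring.
  apply: lerD.
    by apply: ler_wpM2r => //; exact: ler_wpM2l.
  apply: ler_wpM2l; first exact: mulr_ge0.
  by rewrite expr2 ler_piMr //; lra.
have a12 : a <= 1 / 2.
  apply: (le_trans aB); apply: le_trans Bh1; exact: ler_wpM2l.
have e1 : 1 + a <= expR a by exact: expR_ge1Dx.
(* [(1 - a) * expR a <= 1], and [(1 - a) * (1 + a + 2 * a^2) = 1 + a^2 * (1 - 2 * a)]. *)
have e2 : expR a <= 1 + a + 2 * a ^+ 2.
  have a1 : 0 < 1 - a by lra.
  rewrite -(ler_pM2r a1); apply: (@le_trans _ _ 1).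
    apply: (@le_trans _ _ (expR a * expR (- a))).
      by rewrite ler_pM2l ?expR_gt0 //; exact: expRN_ge.
    by rewrite -expRD subrr expR0.
  have : 0 <= a ^+ 2 * (1 - 2 * a) by rewrite mulr_ge0 ?sqr_ge0 //; lra.
  by rewrite !expr2; lra.
have a2 : a ^+ 2 <= B ^+ 2 * h ^+ 2.
  by rewrite -exprMn ler_pXn2r // ?nnegrE // mulr_ge0.
have e3 : `|expR a - 1 - a| <= 2 * B ^+ 2 * h ^+ 2.
  rewrite ger0_norm; last by lra.
  by rewrite -mulrA; lra.
have -> : expR a - 1 - h * y * Phi l = (expR a - 1 - a) + (a - h * y * Phi l) by ring.
by apply: (le_trans (ler_normD _ _)); rewrite mulrDl lerD.
Qed.

Lemma measurable_expR_increment (h y : R) : 0 <= h ->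
  measurable_fun setT (fun w => expR (- (X h w - y))).
Proof.
move=> h0; apply: measurableT_comp => //; apply: measurableT_comp => //.
by apply: measurable_funB => //; exact: measurable_process.
Qed.

Lemma expR_increment_le (h y K : R) w : 0 <= h -> 0 <= y <= K ->
  0 <= expR (- (X h w - y)) <= expR K.
Proof.
move=> h0 /andP[y0 yK]; rewrite expR_ge0 ler_expR.
have := markov_ge0 hM w h0; lra.
Qed.

Lemma horner_increment_integrable (p : {poly R}) (h y : R) : 0 <= h -> 0 <= y ->
  (P y).-integrable setT (EFin \o (fun w =>
     p.[expR (- (X h w - y))] * (1 - expR (- (X h w - y))) ^+ 2)).
Proof.
move=> h0 y0.
pose q := p * (1 - 'X) ^+ 2.
have [B B0 HB] := horner_bounded q (expR y).
have qE u : p.[u] * (1 - u) ^+ 2 = q.[u] by rewrite /q !hornerE.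
apply: (@bounded_integrable _ _ _ B) => //.
  apply: (eq_measurable_fun (fun w => q.[expR (- (X h w - y))])).
    by move=> w _; rewrite qE.
  apply: measurableT_comp; first exact: measurable_horner.
  exact: measurable_expR_increment.
by move=> w; rewrite qE; apply: HB; apply: expR_increment_le => //; rewrite y0 lexx.
Qed.

Lemma horner_levy_bound (p : {poly R}) : exists2 C, 0 <= C & forall t, 0 < t ->
  `|p.[expR (- t)] * (1 - expR (- t)) ^+ 2| <= C * levy_weight t.
Proof.
have [B B0 HB] := horner_bounded p 1.
exists B => // t /ltW t0; have /andP[w0 w1] := one_sub_expRN_sqr_le t0.
rewrite normrM (ger0_norm w0); apply: ler_pM => //.
by apply: HB; rewrite expR_ge0 expRN_le1.
Qed.

Lemma measurable_horner_levy (p : {poly R}) (D : set R) :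
  measurable_fun D (fun t => p.[expR (- t)] * (1 - expR (- t)) ^+ 2).
Proof.
have mE : measurable_fun setT (fun t : R => expR (- t)).
  by apply: measurableT_comp.
apply: measurable_funTS; apply: measurable_funM.
  exact: (measurableT_comp (measurable_horner p) mE).
by apply: measurable_funX; exact: measurable_funB.
Qed.

Lemma horner_levy_integrable (p : {poly R}) : pi.-integrable Dpos
  (EFin \o (fun t => p.[expR (- t)] * (1 - expR (- t)) ^+ 2)).
Proof.
have [C _ HC] := horner_levy_bound p.
apply: (levy_integrable hPhi _ HC); exact: measurable_horner_levy.
Qed.

(** The value at [0] of the generator of the Lévy process with Laplace exponent [Phi], applied to
    [z |-> p(e^-z) * (1 - e^-z)^2]. This function vanishes to second order at [0], where its second
    derivative is [2 * p.[1]]. *)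
Let Lambda (p : {poly R}) : R :=
  2 * beta * p.[1] +
  \int[pi]_(t in Dpos) (p.[expR (- t)] * (1 - expR (- t)) ^+ 2).

Let increment_mean (p : {poly R}) (h y : R) : R :=
  \int[P y]_w (p.[expR (- (X h w - y))] * (1 - expR (- (X h w - y))) ^+ 2).

Let LambdaD p q : Lambda (p + q) = Lambda p + Lambda q.
Proof.
rewrite /Lambda.
have -> : \int[pi]_(t in Dpos) ((p + q).[expR (- t)] * (1 - expR (- t)) ^+ 2) =
  \int[pi]_(t in Dpos) (p.[expR (- t)] * (1 - expR (- t)) ^+ 2
    + q.[expR (- t)] * (1 - expR (- t)) ^+ 2).
  by apply: eq_Rintegral => t _; rewrite hornerD mulrDl.
rewrite RintegralD //; [|exact: horner_levy_integrable|exact: horner_levy_integrable].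
by rewrite hornerD; ring.
Qed.

Let LambdaZ c p : Lambda (c *: p) = c * Lambda p.
Proof.
rewrite /Lambda.
have -> : \int[pi]_(t in Dpos) ((c *: p).[expR (- t)] * (1 - expR (- t)) ^+ 2) =
  \int[pi]_(t in Dpos) (c * (p.[expR (- t)] * (1 - expR (- t)) ^+ 2)).
  by apply: eq_Rintegral => t _; rewrite hornerZ mulrA.
rewrite RintegralZl //; last exact: horner_levy_integrable.
by rewrite hornerZ; ring.
Qed.

Let increment_meanD p q h y : 0 <= h -> 0 <= y ->
  increment_mean (p + q) h y = increment_mean p h y + increment_mean q h y.
Proof.
move=> h0 y0; rewrite /increment_mean -RintegralD //;
  [|exact: horner_increment_integrable|exact: horner_increment_integrable].
by apply: eq_Rintegral => w _; rewrite hornerD mulrDl.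
Qed.

Let increment_meanZ c p h y : 0 <= h -> 0 <= y ->
  increment_mean (c *: p) h y = c * increment_mean p h y.
Proof.
move=> h0 y0; rewrite /increment_mean -RintegralZl //;
  last exact: horner_increment_integrable.
by apply: eq_Rintegral => w _; rewrite hornerZ -mulrA.
Qed.

(** [u^n * (1 - u)^2] is a second difference of exponentials with exponents [n], [n + 1], [n + 2].
    The constants [1] cancel, and the remaining error of order [h^2] is below [h * e] once
    [h <= e / C]. *)
Let small_time_monomial (n : nat) (K e : R) : 0 <= K -> 0 < e ->
  exists2 h0, 0 < h0 & forall h y, 0 <= h <= h0 -> 0 <= y <= K ->
    `|increment_mean 'X^n h y - h * y * Lambda 'X^n| <= h * e.
Proof.
move=> K0 e0; pose l : R := n%:R.
have l0 : 0 <= l by [].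
have l10 : 0 <= l + 1 by lra.
have l20 : 0 <= l + 2 by lra.
have [C0 [a0 [C00 a00 H0]]] := laplace_small_time K0 l0.
have [C1 [a1 [C10 a10 H1]]] := laplace_small_time K0 l10.
have [C2 [a2 [C20 a20 H2]]] := laplace_small_time K0 l20.
pose C := C0 + 2 * C1 + C2 + 1.
have Cp : 0 < C by rewrite /C; lra.
exists (Num.min (Num.min a0 a1) (Num.min a2 (e / C))).
  by rewrite !lt_min a00 a10 a20 divr_gt0.
move=> h y /andP[h0]; rewrite !le_min => /andP[/andP[ha0 ha1] /andP[ha2 hC]] yK.
have /andP[y0 _] := yK.
have {}H0 := H0 h y _ yK; have {}H1 := H1 h y _ yK; have {}H2 := H2 h y _ yK.
rewrite h0 /= in H0 H1 H2.
have {H0} := H0 ha0; have {H1} := H1 ha1; have {H2} := H2 ha2.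
set E2 := Rintegral _ _ _; set E1 := Rintegral _ _ _; set E0 := Rintegral _ _ _.
move=> H2 H1 H0.
have iE k : 0 <= k -> (P y).-integrable setT (EFin \o (fun w => expR (- k * (X h w - y)))).
  move=> k0; apply: (@bounded_integrable _ _ _ (expR (k * y))) => //.
    apply: measurableT_comp => //; apply: measurable_funM => //.
    by apply: measurable_funB => //; exact: measurable_process.
  move=> w; rewrite ger0_norm ?expR_ge0 // ler_expR mulrBr !mulNr.
  have : 0 <= k * X h w by rewrite mulr_ge0 // (markov_ge0 hM).
  by lra.
have -> : increment_mean 'X^n h y = E0 - 2 * E1 + E2.
  rewrite /E0 /E1 /E2 /increment_mean -RintegralZl //; last exact: iE.
  rewrite -RintegralB //; [|exact: iE|by apply: integrableZlr => //; exact: iE].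
  rewrite -RintegralD //; [|by apply: integrableBr => //; [exact: iE|apply: integrableZlr => //; exact: iE]|exact: iE].
  apply: eq_Rintegral => w _.
  rewrite hornerXn -expRM_natl -/l.
  set z := X h w - y.
  have -> : - (l + 1) * z = l * - z + - z by ring.
  have -> : - (l + 2) * z = l * - z + - z + - z by ring.
  have -> : - l * z = l * - z by ring.
  by rewrite !expRD; ring.
have -> : Lambda 'X^n = Phi l - 2 * Phi (l + 1) + Phi (l + 2).
  rewrite branching_second_difference // /Lambda hornerXn expr1n mulr1; congr (_ + _).
  apply: eq_Rintegral => t _; rewrite hornerXn -expRM_natl -/l.
  by rewrite mulrN mulNr.
have -> : E0 - 2 * E1 + E2 - h * y * (Phi l - 2 * Phi (l + 1) + Phi (l + 2)) =
  (E0 - 1 - h * y * Phi l) - 2 * (E1 - 1 - h * y * Phi (l + 1))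
  + (E2 - 1 - h * y * Phi (l + 2)) by ring.
apply: (@le_trans _ _ (C * h ^+ 2)); last first.
  rewrite expr2 mulrCA; apply: ler_wpM2l => //.
  by rewrite mulrC -ler_pdivlMr.
have h2 : 0 <= h ^+ 2 by exact: sqr_ge0.
apply: (@le_trans _ _ (C0 * h ^+ 2 + 2 * (C1 * h ^+ 2) + C2 * h ^+ 2)); last first.
  by rewrite /C; lra.
apply: (le_trans (ler_normD _ _)); apply: lerD => //.
apply: (le_trans (ler_normB _ _)); apply: lerD => //.
by rewrite normrM ger0_norm // ler_pM2l.
Qed.

Lemma small_time_poly (p : {poly R}) (K e : R) : 0 <= K -> 0 < e ->
  exists2 h0, 0 < h0 & forall h y, 0 <= h <= h0 -> 0 <= y <= K ->
    `|increment_mean p h y - h * y * Lambda p| <= h * e.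
Proof.
move=> K0 e0; rewrite -[p]coefK poly_def.
elim: (size p) e e0 => [|n IH] e e0.
  exists 1 => // h y /andP[h0 _] _; rewrite big_ord0.
  have -> : Lambda 0 = 0 by rewrite -(scale0r 0) LambdaZ mul0r.
  rewrite mulr0 subr0 /increment_mean.
  rewrite (_ : Rintegral _ _ _ = \int[P y]_w (0 : R)); last first.
    by apply: eq_Rintegral => w _; rewrite horner0 mul0r.
  by rewrite Rintegral_probability_cst normr0 mulr_ge0 // ltW.
have e20 : 0 < e / 2 by rewrite divr_gt0.
have [a a0 Ha] := IH _ e20.
pose c := `|p`_n| + 1.
have c0 : 0 < c by rewrite ltr_wpDl.
have ec0 : 0 < e / 2 / c by rewrite divr_gt0.
have [b b0 Hb] := small_time_monomial n K0 ec0.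
exists (Num.min a b); first by rewrite lt_min a0.
move=> h y /andP[h0]; rewrite le_min => /andP[ha hb] yK.
have {Ha} := Ha h y _ yK; rewrite h0 ha => /(_ isT) Ha.
have {Hb} := Hb h y _ yK; rewrite h0 hb => /(_ isT) Hb.
have /andP[y0 _] := yK.
rewrite big_ord_recr /= LambdaD LambdaZ increment_meanD // increment_meanZ //.
move: Ha Hb; set q := \sum_(i < n) _; set r := 'X^n.
move: (increment_mean q h y) (Lambda q) (increment_mean r h y) (Lambda r).
move=> A B A' B' Ha Hb.
have -> : A + p`_n * A' - h * y * (B + p`_n * B') =
  (A - h * y * B) + p`_n * (A' - h * y * B') by ring.
have -> : h * e = h * (e / 2) + h * (e / 2) by field.
apply: (le_trans (ler_normD _ _)); apply: lerD => //.
rewrite normrM; apply: (@le_trans _ _ (c * (h * (e / 2 / c)))).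
  by apply: ler_pM => //; rewrite /c lerDl.
by rewrite le_eqVlt; apply/orP; left; apply/eqP; field; lra.
Qed.

Lemma Rintegral_probability_indic (y : R) (E : set Omega) : measurable E ->
  \int[P y]_w \1_E w = fine (P y E).
Proof. by move=> mE; rewrite /Rintegral integral_indic // setIT. Qed.

Lemma probability_indic_integrable (y : R) (E : set Omega) : measurable E ->
  (P y).-integrable setT (EFin \o \1_E).
Proof.
move=> mE; apply: (@bounded_integrable _ _ _ 1) => //.
move=> w; rewrite indicE ger0_norm //.
by case: (w \in E).
Qed.

Lemma fine_probabilityK (y : R) (E : set Omega) : measurable E ->
  (fine (P y E))%:E = P y E.
Proof. by move=> mE; rewrite fineK // fin_num_measure. Qed.

Lemma measurable_increment (h y r : R) : 0 <= h ->
  measurable [set w | r < X h w - y].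
Proof.
move=> h0; have -> : [set w | r < X h w - y] = X h @^-1` `]r + y, +oo[%classic.
  by apply/seteqP; split => w; rewrite /= in_itv /= andbT ltrBrDr.
rewrite -[X in measurable X]setTI; apply: (@measurable_process _ setT) => //.
Qed.

Let tail_indic_integrable (r : R) : 0 < r ->
  pi.-integrable Dpos (EFin \o \1_(`]r, +oo[%classic)).
Proof.
move=> r0; apply/integrableP; split.
  by apply/measurable_EFinP; exact: measurable_indic.
under eq_integral do rewrite /= ger0_norm //.
rewrite integral_indic //; apply: (@le_lt_trans _ _ (pi `]r, +oo[%classic)).
  by apply: le_measure; rewrite ?inE //; exact: measurableI.
by rewrite (levy_tailE hPhi) // ltry.
Qed.

Let tail_Rintegral (r : R) : 0 < r ->
  \int[pi]_(t in Dpos) \1_(`]r, +oo[%classic) t = levy_tail pi r.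
Proof.
move=> r0; rewrite /Rintegral integral_indic // setIidl //.
by move=> t; rewrite /Dpos /= !in_itv /= !andbT; exact: lt_trans.
Qed.

Let sqr_weight_integrable (c : R) :
  pi.-integrable Dpos (EFin \o (fun t => c * (1 - expR (- t)) ^+ 2)).
Proof.
apply: integrableZlr => //.
apply: eq_integrable (horner_levy_integrable 1) => // t _.
by rewrite /= hornerC mul1r.
Qed.

Let sqr_weight_mass :
  0 <= \int[pi]_(t in Dpos) ((1 - expR (- t)) ^+ 2) <= levy_mass pi.
Proof.
apply/andP; split.
  by apply: Rintegral_ge0 => t _; exact: sqr_ge0.
have := sqr_weight_integrable 1; under eq_fun do rewrite mul1r; move=> i1.
apply: le_Rintegral => //; first exact: (levy_weight_integrable hPhi).
move=> t; rewrite /Dpos /= in_itv /= andbT => /ltW t0.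
by have /andP[] := one_sub_expRN_sqr_le t0.
Qed.

Section small_time_jump.
Context (r1 r2 K e : R) (r10 : 0 < r1) (r12 : r1 < r2) (K0 : 0 <= K) (e0 : 0 < e).

(** Approximation within [eta] costs at most [(4 * beta + 2 * levy_mass pi) * eta] in [Lambda].
    Multiplied by a state up to [K] this stays below [e / 2]; the other half is left to the
    small-time error. *)
Let eta := e / (2 * (K * (4 * beta + 2 * levy_mass pi) + 1)).

Let mass0 : 0 <= levy_mass pi := levy_mass_ge0 pi.
Let beta0 : 0 <= beta := branching_beta_ge0 hPhi.

Let c0 : 0 <= K * (4 * beta + 2 * levy_mass pi).
Proof. by rewrite mulr_ge0 // addr_ge0 // mulr_ge0. Qed.

Let eta0 : 0 < eta.
Proof. by rewrite divr_gt0 // mulr_gt0 // ltr_wpDl. Qed.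

Let etaP y : 0 <= y <= K -> y * ((4 * beta + 2 * levy_mass pi) * eta) <= e / 2.
Proof.
move=> /andP[y0 yK].
have -> : e / 2 = (K * (4 * beta + 2 * levy_mass pi) + 1) * eta.
  by rewrite /eta; field; have := c0; lra.
rewrite mulrA; apply: ler_wpM2r; first exact: ltW.
apply: (@le_trans _ _ (K * (4 * beta + 2 * levy_mass pi))); last by lra.
by apply: ler_wpM2r => //; rewrite addr_ge0 // mulr_ge0.
Qed.

Let exp_tail (r t : R) : (expR (- t) < expR (- r))%R%:R = \1_(`]r, +oo[%classic) t :> R.
Proof. by rewrite ltr_expR ltrN2 indicE mem_setE in_itv /= andbT. Qed.

Let exp_event (r h y : R) w :
  (expR (- (X h w - y)) < expR (- r))%R%:R = \1_[set w | r < X h w - y] w :> R.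
Proof.
rewrite ltr_expR ltrN2 indicE; congr ((nat_of_bool _)%:R).
by apply/idP/idP; rewrite inE.
Qed.

Lemma small_time_jump_le : exists2 h0, 0 < h0 &
  forall h y, 0 <= h <= h0 -> 0 <= y <= K ->
    fine (P y [set w | r2 < X h w - y]) <= h * (levy_tail pi r1 * y + e).
Proof.
have [p [p1 Hp]] := threshold_poly r10 r12 K0 eta0.
(* Adding [eta] turns the approximation into a true majorant of the indicator of increments above
   [r2]. It has to hold for [u] up to [expR K], since an increment can be as low as [- y]. *)
pose q := p + eta%:P.
have e2 : 0 < e / 2 by rewrite divr_gt0.
have [h0 h00 Hh] := small_time_poly q K0 e2.
exists h0 => // h y hh yK; have /andP[h_ge0 _] := hh; have /andP[y0 _] := yK.
have := Hh h y hh yK; rewrite ler_norml => /andP[_].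
set E := [set w | _]; have mE : measurable E by exact: measurable_increment.
have : fine (P y E) <= increment_mean q h y.
  rewrite -Rintegral_probability_indic //; apply: le_Rintegral => //.
  - exact: probability_indic_integrable.
  - exact: horner_increment_integrable.
  - move=> w _; rewrite -exp_event /q hornerD hornerC mulrDl.
    have /andP[] := Hp _ (expR_increment_le w h_ge0 yK); lra.
have : Lambda q <= levy_tail pi r1 + (4 * beta + 2 * levy_mass pi) * eta.
  rewrite /Lambda.
  have : 2 * beta * q.[1] <= 4 * beta * eta.
    have -> : 4 * beta * eta = 2 * beta * (eta + eta) by ring.
    apply: ler_wpM2l; first by rewrite mulr_ge0.
    by rewrite /q hornerD hornerC lerD2r (le_trans (ler_norm _)).
  have : \int[pi]_(t in Dpos) (q.[expR (- t)] * (1 - expR (- t)) ^+ 2) <=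
      levy_tail pi r1 + 2 * eta * levy_mass pi.
    apply: (@le_trans _ _ (\int[pi]_(t in Dpos) (\1_(`]r1, +oo[%classic) t +
        2 * eta * (1 - expR (- t)) ^+ 2))).
      apply: le_Rintegral => //.
      - exact: horner_levy_integrable.
      - by apply: integrableDr => //; exact: tail_indic_integrable.
      - move=> t; rewrite /Dpos /= in_itv /= andbT => /ltW t0.
        rewrite -exp_tail /q hornerD hornerC mulrDl.
        have := Hp (expR (- t)); rewrite expR_ge0 /= ler_expR.
        have -> : - t <= K by lra.
        by move=> /(_ isT) /andP[]; lra.
    rewrite RintegralD //; last exact: tail_indic_integrable.
    rewrite tail_Rintegral // lerD2l.
    rewrite RintegralZl //; last first.
      by have := sqr_weight_integrable 1; under eq_fun do rewrite mul1r.
    apply: ler_wpM2l; first by rewrite mulr_ge0 // ltW.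
    by have /andP[] := sqr_weight_mass.
  by lra.
move=> hL hE hD.
have h1 : h * y * Lambda q <=
    h * y * (levy_tail pi r1 + (4 * beta + 2 * levy_mass pi) * eta).
  by apply: ler_wpM2l => //; rewrite mulr_ge0.
have h2 : h * (y * ((4 * beta + 2 * levy_mass pi) * eta)) <= h * (e / 2).
  by apply: ler_wpM2l => //; exact: etaP.
by lra.
Qed.

Lemma small_time_jump_ge : exists2 h0, 0 < h0 &
  forall h y, 0 <= h <= h0 -> 0 <= y <= K ->
    h * (levy_tail pi r2 * y) <= fine (P y [set w | r1 < X h w - y]) + h * e.
Proof.
have [p [p1 Hp]] := threshold_poly r10 r12 K0 eta0.
have r20 : 0 < r2 by exact: lt_trans r12.
(* Subtracting [eta] gives a true minorant of the indicator of increments above [r1]. *)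
pose q := p - eta%:P.
have e2 : 0 < e / 2 by rewrite divr_gt0.
have [h0 h00 Hh] := small_time_poly q K0 e2.
exists h0 => // h y hh yK; have /andP[h_ge0 _] := hh; have /andP[y0 _] := yK.
have := Hh h y hh yK; rewrite ler_norml => /andP[+ _].
set E := [set w | _]; have mE : measurable E by exact: measurable_increment.
have : increment_mean q h y <= fine (P y E).
  rewrite -Rintegral_probability_indic //; apply: le_Rintegral => //.
  - exact: horner_increment_integrable.
  - exact: probability_indic_integrable.
  - move=> w _; rewrite -exp_event /q hornerD hornerN hornerC mulrBl.
    have /andP[] := Hp _ (expR_increment_le w h_ge0 yK); lra.
have : levy_tail pi r2 - (4 * beta + 2 * levy_mass pi) * eta <= Lambda q.
  rewrite /Lambda.
  have : - (4 * beta * eta) <= 2 * beta * q.[1].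
    have -> : - (4 * beta * eta) = 2 * beta * (- eta - eta) by ring.
    apply: ler_wpM2l; first by rewrite mulr_ge0.
    rewrite /q hornerD hornerN hornerC lerD2r.
    by move: p1; rewrite ler_norml => /andP[].
  have : levy_tail pi r2 - 2 * eta * levy_mass pi <=
      \int[pi]_(t in Dpos) (q.[expR (- t)] * (1 - expR (- t)) ^+ 2).
    apply: (@le_trans _ _ (\int[pi]_(t in Dpos) (\1_(`]r2, +oo[%classic) t -
        2 * eta * (1 - expR (- t)) ^+ 2))); last first.
      apply: le_Rintegral => //.
      - by apply: integrableBr => //; exact: tail_indic_integrable.
      - exact: horner_levy_integrable.
      - move=> t; rewrite /Dpos /= in_itv /= andbT => /ltW t0.
        rewrite -exp_tail /q hornerD hornerN hornerC mulrBl.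
        have := Hp (expR (- t)); rewrite expR_ge0 /= ler_expR.
        have -> : - t <= K by lra.
        by move=> /(_ isT) /andP[]; lra.
    rewrite RintegralB //; last exact: tail_indic_integrable.
    rewrite tail_Rintegral // lerD2l lerN2.
    rewrite RintegralZl //; last first.
      by have := sqr_weight_integrable 1; under eq_fun do rewrite mul1r.
    apply: ler_wpM2l; first by rewrite mulr_ge0 // ltW.
    by have /andP[] := sqr_weight_mass.
  by lra.
move=> hL hE hD.
have h1 : h * y * (levy_tail pi r2 - (4 * beta + 2 * levy_mass pi) * eta)
    <= h * y * Lambda q.
  by apply: ler_wpM2l => //; rewrite mulr_ge0.
have h2 : h * (y * ((4 * beta + 2 * levy_mass pi) * eta)) <= h * (e / 2).
  by apply: ler_wpM2l => //; exact: etaP.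
by lra.
Qed.

End small_time_jump.

(** * Large increments on a grid *)

Section one_step.
Context (x s h r delta K : R) (A : set Omega).
Context (x0 : 0 <= x) (s0 : 0 <= s) (h0 : 0 <= h) (delta0 : 0 < delta).
Context (FA : natural_filtration X s A).

Let A' := A `&` [set w | X s w <= K].
Let J := [set w | r < X (s + h) w - X s w].
Let bin (j : nat) := X s @^-1` `[j%:R * delta, j.+1%:R * delta[%classic.

Let sh0 : 0 <= s + h. Proof. exact: addr_ge0. Qed.

Let FA' : natural_filtration X s A'.
Proof.
apply: filtrationI => //; have -> : [set w | X s w <= K] = X s @^-1` `]-oo, K]%classic.
  by apply/seteqP; split => w; rewrite /= in_itv.
by apply: filtration_preimage.
Qed.

Let Fbin j : natural_filtration X s (A' `&` bin j).
Proof. by apply: filtrationI => //; exact: filtration_preimage. Qed.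

Let mbin j : measurable (A' `&` bin j).
Proof. exact: filtration_measurable (Fbin j). Qed.

Let mJ : measurable J.
Proof.
have -> : J = (fun w => X (s + h) w - X s w) @^-1` `]r, +oo[%classic.
  by apply/seteqP; split => w; rewrite /= in_itv /= andbT.
rewrite -[X in measurable X]setTI.
suff : measurable_fun setT (fun w => X (s + h) w - X s w) by apply => //.
by apply: measurable_funB; exact: measurable_process.
Qed.

Let bin_cover : A' = \bigcup_j (A' `&` bin j).
Proof.
rewrite -setI_bigcupr; apply/esym/setIidl => w _.
have X0 : 0 <= X s w by exact: (markov_ge0 hM).
exists (Num.truncn (X s w / delta)) => //; rewrite /bin /= in_itv /=.
have /truncn_itv /andP[h1 h2] : 0 <= X s w / delta by rewrite divr_ge0 // ltW.
by rewrite -ler_pdivlMr // h1 -ltr_pdivrMr.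
Qed.

Let bin_triv : trivIset setT (fun j => A' `&` bin j).
Proof.
apply/trivIsetP => i j _ _ /eqP ij; apply/seteqP; split => // w [[_ +] [_ +]].
rewrite /bin /= !in_itv /= => /andP[i1 i2] /andP[j1 j2]; apply: ij.
have := le_lt_trans i1 j2; have := le_lt_trans j1 i2.
by rewrite !ltr_pM2r // !ltr_nat !ltnS => ji ij; apply/eqP; rewrite eqn_leq ij.
Qed.

Let bin_markov j (r' : R) :
  P x (A' `&` bin j `&` [set w | r' < X (s + h) w]) =
  (\int[P x]_(w in A' `&` bin j) P (X s w) [set w' | (r' < X h w')%R])%E.
Proof.
have E u : [set w | r' < X u w] = X u @^-1` `]r', +oo[%classic.
  by apply/seteqP; split => w; rewrite /= in_itv /= andbT.
by rewrite !E; apply: (markov_property hM).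
Qed.

Let measurable_transition (r' : R) (C : set Omega) : measurable C ->
  measurable_fun C (fun w => P (X s w) [set w' | (r' < X h w')%R]).
Proof.
move=> mC.
have -> : [set w | r' < X h w] = X h @^-1` `]r', +oo[%classic.
  by apply/seteqP; split => w; rewrite /= in_itv /= andbT.
apply: (@measurable_comp _ _ _ _ _ _ (`[0, +oo[%classic : set R)
  (fun z => P z (X h @^-1` `]r', +oo[%classic))) => //.
- by move=> _ [w _ <-]; rewrite /= in_itv /= andbT; exact: (markov_ge0 hM).
- exact: (markov_kernel hM).
- exact: measurable_process.
Qed.

Let integral_J (C : set Omega) : measurable C ->
  (\int[P x]_(w in C) (\1_J w)%:E = P x (C `&` J))%E.
Proof. by move=> mC; rewrite integral_indic // setIC. Qed.

Let A'_in w : A' w -> 0 <= X s w <= K.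
Proof. by move=> [_ /= ->]; rewrite (markov_ge0 hM). Qed.

Let measurable_affine (c1 c2 : R) (C : set Omega) :
  measurable_fun C (fun w => (c1 * X s w + c2)%:E).
Proof.
apply/measurable_EFinP; apply: measurable_funD => //.
by apply: measurable_funM => //; exact: measurable_process.
Qed.

Let measurable_indicE (C E : set Omega) : measurable E ->
  measurable_fun C (fun w => (\1_E w)%:E : \bar R).
Proof. by move=> mE; apply/measurable_EFinP; exact: measurable_indic. Qed.

Let fineP (y : R) (E : set Omega) (c : R) : measurable E ->
  fine (P y E) <= c -> (P y E <= c%:E)%E.
Proof. by move=> mE H; rewrite -fine_probabilityK // lee_fin. Qed.

Let affine_ge0 (c1 c2 : R) w : 0 <= c1 -> 0 <= c2 -> (0 <= (c1 * X s w + c2)%:E)%E.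
Proof.
by move=> c10 c20; rewrite lee_fin addr_ge0 // mulr_ge0 // (markov_ge0 hM).
Qed.

Let Rintegral_affine (c1 c2 : R) : 0 <= c2 ->
  \int[P x]_(w in A') (c1 * X s w + c2) <= c1 * \int[P x]_(w in A') X s w + c2.
Proof.
have mA' := filtration_measurable FA'.
move=> c20; rewrite RintegralD //; last 2 first.
- by apply: integrableZlr => //; exact: process_integrable.
- by apply: (@bounded_integrable _ _ _ `|c2|).
rewrite RintegralZl //; last exact: process_integrable.
rewrite lerD2l Rintegral_cst // -[leRHS]mulr1; apply: ler_wpM2l => //.
by rewrite -lee_fin fine_probabilityK // probability_le1.
Qed.

(* Splitting according to the integer part of [X s / delta] turns the increment,
   which involves both times, into events about [X (s + h)] alone. *)
Lemma one_step_le (kappa e : R) : 0 <= kappa -> 0 <= e ->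
  (forall y, 0 <= y <= K ->
     fine (P y [set w | r - delta < X h w - y]) <= h * (kappa * y + e)) ->
  fine (P x (A' `&` J)) <= h * kappa * \int[P x]_(w in A') X s w + h * e.
Proof.
move=> k0 e0 H; have mA' := filtration_measurable FA'.
apply: le_trans (Rintegral_affine _ _); last exact: mulr_ge0.
have i1 : (P x).-integrable A' (EFin \o (fun w => h * kappa * X s w + h * e)).
  apply: integrableDr => //; first by apply: integrableZlr => //; exact: process_integrable.
  by apply: (@bounded_integrable _ _ _ `|h * e|).
rewrite -lee_fin fine_probabilityK; last exact: measurableI.
rewrite /Rintegral fineK; last exact: integrable_fin_num.
rewrite -integral_J // {1 2}bin_cover.
rewrite ge0_integral_bigcup //; last exact: measurable_indicE.
rewrite ge0_integral_bigcup //; last by move=> w _; apply: affine_ge0; rewrite mulr_ge0.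
apply: lee_nneseries => [j _ _|j _].
  by apply: integral_ge0 => w _; rewrite lee_fin.
rewrite integral_J //.
(* On bin [j] the state is at least [j * delta], so the increment pushes [X (s + h)] above
   [r + j * delta]. Conversely the state is below [(j + 1) * delta], so passing that level means an
   increment above [r - delta]. *)
apply: (@le_trans _ _ (P x (A' `&` bin j `&` [set w | r + j%:R * delta < X (s + h) w]))).
  apply: le_measure; rewrite ?inE.
  - exact: measurableI.
  - apply: measurableI => //.
    have := @measurable_increment (s + h) 0 (r + j%:R * delta) sh0.
    by under eq_set do rewrite subr0.
  - move=> w [[A'w bw] Jw]; split => //; move: bw Jw.
    by rewrite /bin /J /= in_itv /= => /andP[]; lra.
rewrite bin_markov; apply: ge0_le_integral => //.
- exact: measurable_transition.
- move=> w [A'w bw]; have y0K := A'_in A'w; have /andP[y0 _] := y0K.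
  have := H _ y0K; rewrite mulrDr mulrA; move/fineP => /(_ (measurable_increment _ _ h0)).
  apply: le_trans; apply: le_measure; rewrite ?inE.
  + have := @measurable_increment h 0 (r + j%:R * delta) h0.
    by under eq_set do rewrite subr0.
  + exact: measurable_increment.
  + move=> w' /=; move: bw; rewrite /bin /= in_itv /= => /andP[].
    by rewrite -natr1 mulrDl mul1r; lra.
Qed.

Lemma one_step_ge (kappa e : R) : 0 <= kappa -> 0 <= e ->
  (forall y, 0 <= y <= K ->
     h * (kappa * y) <= fine (P y [set w | r + delta < X h w - y]) + h * e) ->
  h * kappa * \int[P x]_(w in A') X s w <= fine (P x (A' `&` J)) + h * e.
Proof.
move=> k0 e0 H; have mA' := filtration_measurable FA'.
have he0 : 0 <= h * e by exact: mulr_ge0.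
have i1 : (P x).-integrable A' (EFin \o (fun w => h * kappa * X s w + 0)).
  apply: integrableDr => //; first by apply: integrableZlr => //; exact: process_integrable.
  by apply: (@bounded_integrable _ _ _ 0) => // w; rewrite normr0.
apply: (@le_trans _ _ (\int[P x]_(w in A') (h * kappa * X s w + 0))).
  by under [leRHS]eq_Rintegral do rewrite addr0; rewrite RintegralZl //; exact: process_integrable.
have mJA : measurable (A' `&` J) by exact: measurableI.
rewrite -lee_fin EFinD fine_probabilityK //.
rewrite /Rintegral fineK; last exact: integrable_fin_num.
apply: (@le_trans _ _ (\int[P x]_(w in A') ((\1_J w)%:E + (h * e)%:E))%E); last first.
  rewrite ge0_integralD //; last exact: measurable_indicE.
  rewrite integral_J // leeD2l // integral_cst // -[leRHS]mule1.
  by apply: lee_wpmul2l; [rewrite lee_fin|exact: probability_le1].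
rewrite {1 2}bin_cover.
rewrite ge0_integral_bigcup //; last by move=> w _; apply: affine_ge0 => //; rewrite mulr_ge0.
rewrite ge0_integral_bigcup //; last 2 first.
- by apply: emeasurable_funD => //; exact: measurable_indicE.
- by move=> w _; rewrite adde_ge0 // lee_fin.
apply: lee_nneseries => [j _ _|j _].
  by apply: integral_ge0 => w _; apply: affine_ge0 => //; rewrite mulr_ge0.
rewrite ge0_integralD //; last exact: measurable_indicE.
rewrite integral_J //.
(* The level is now [r + (j + 1) * delta]: passing it from bin [j] needs an increment above [r], and
   any increment above [r + delta] achieves it. *)
apply: (@le_trans _ _ (P x (A' `&` bin j `&` [set w | (r + j.+1%:R * delta < X (s + h) w)%R])
   + \int[P x]_(w in A' `&` bin j) (h * e)%:E)%E); last first.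
  rewrite leeD2r //; apply: le_measure; rewrite ?inE.
  - apply: measurableI => //.
    have := @measurable_increment (s + h) 0 (r + j.+1%:R * delta) sh0.
    by under eq_set do rewrite subr0.
  - exact: measurableI.
  - move=> w [[A'w bw] Jw]; split => //; move: bw Jw.
    by rewrite /bin /J /= in_itv /= => /andP[]; lra.
rewrite bin_markov -ge0_integralD //; last exact: measurable_transition.
apply: ge0_le_integral => //.
- by move=> w _; apply: affine_ge0 => //; rewrite mulr_ge0.
- by apply: emeasurable_funD => //; exact: measurable_transition.
- move=> w [A'w bw]; have y0K := A'_in A'w; have /andP[y0 _] := y0K.
  apply: (@le_trans _ _ (P (X s w) [set w0 | (r + delta < X h w0 - X s w)%R]
    + (h * e)%:E)%E).
    rewrite -(@fine_probabilityK _ [set w0 | _]); last exact: measurable_increment.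
    by rewrite -EFinD lee_fin addr0 -mulrA; exact: H.
  rewrite leeD2r //; apply: le_measure; rewrite ?inE.
  + exact: measurable_increment.
  + have := @measurable_increment h 0 (r + j.+1%:R * delta) h0.
    by under eq_set do rewrite subr0.
  + move=> w' /=; move: bw; rewrite /bin /= in_itv /= => /andP[].
    by rewrite -natr1 mulrDl mul1r; lra.
Qed.

End one_step.

Let Rint_ge0 (x t : R) (A : set Omega) : 0 <= t -> 0 <= \int[P x]_(w in A) X t w.
Proof. by move=> t0; apply: Rintegral_ge0 => w _; exact: (markov_ge0 hM). Qed.

Lemma process_Rintegral_setC (x t : R) (A : set Omega) : 0 <= x -> 0 <= t ->
  measurable A ->
  \int[P x]_(w in A) X t w + \int[P x]_(w in ~` A) X t w
  = x * expR (- (alpha * t)).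
Proof.
move=> x0 t0 mA; rewrite -mean_process_Rintegral // -Rintegral_setU.
- by rewrite setUv.
- by [].
- exact: measurableC.
- by rewrite setUv; exact: process_integrable.
- exact/disj_setPCl.
Qed.

Lemma process_Rintegral_le (x t : R) (A : set Omega) : 0 <= x -> 0 <= t ->
  measurable A -> \int[P x]_(w in A) X t w <= x * expR (- (alpha * t)).
Proof.
by move=> x0 t0 mA; rewrite -(process_Rintegral_setC x0 t0 mA) lerDl Rint_ge0.
Qed.

(** The factor is enlarged from [expR (alpha * (T - s))] to one free of [s], so that a single bound
    serves all grid times. *)
Lemma supermartingale_le (x s T : R) (A : set Omega) : 0 <= x -> 0 <= s -> s <= T ->
  natural_filtration X s A ->
  \int[P x]_(w in A) X s w <= expR (alpha * T) * \int[P x]_(w in A) X T w.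
Proof.
move=> x0 s0 sT FA; have Ts0 : 0 <= T - s by rewrite subr_ge0.
have := supermartingale x0 s0 Ts0 FA.
have -> : s + (T - s) = T by ring.
rewrite expRN -ler_pdivlMl ?invr_gt0 ?expR_gt0 // invrK => h.
apply: (le_trans h); apply: ler_wpM2r.
  by apply: Rint_ge0; exact: le_trans sT.
by rewrite ler_expR; apply: ler_wpM2l; [exact: ltW|lra].
Qed.

Lemma fine_probabilityU (x : R) (A B : set Omega) : measurable A -> measurable B ->
  A `&` B = set0 -> fine (P x (A `|` B)) = fine (P x A) + fine (P x B).
Proof. by move=> mA mB AB; rewrite measureU // fineD // fin_num_measure. Qed.

Lemma fine_probability_le (x : R) (A B : set Omega) : measurable A -> measurable B ->
  A `<=` B -> fine (P x A) <= fine (P x B).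
Proof.
move=> mA mB AB; apply: fine_le; rewrite ?fin_num_measure //.
by apply: le_measure; rewrite ?inE.
Qed.

Lemma fine_probabilityU_le (x : R) (A B : set Omega) : measurable A -> measurable B ->
  fine (P x (A `|` B)) <= fine (P x A) + fine (P x B).
Proof.
move=> mA mB; rewrite -fineD ?fin_num_measure //; apply: fine_le.
- by rewrite fin_num_measure //; exact: measurableU.
- by rewrite fin_numD !fin_num_measure.
- exact: measureU2.
Qed.

Section grid.
Context (x h : R) (x0 : 0 <= x) (h0 : 0 <= h).

Let tk (k : nat) : R := k%:R * h.
Let tk0 k : 0 <= tk k. Proof. by rewrite mulr_ge0. Qed.
Let tk_le j k : (j <= k)%N -> tk j <= tk k.
Proof. by move=> jk; rewrite ler_wpM2r // ler_nat. Qed.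
Let tkS k : tk k.+1 = tk k + h.
Proof. by rewrite /tk -natr1 mulrDl mul1r. Qed.

Definition exceedance (K : R) (n : nat) : set Omega :=
  [set w | exists2 k, (k < n)%N & K < X (k%:R * h) w].

Definition grid_jump (r : R) (n : nat) : set Omega :=
  [set w | exists2 k, (k < n)%N & r < X (k%:R * h + h) w - X (k%:R * h) w].

Let exceedance0 K : exceedance K 0 = set0.
Proof. by apply/seteqP; split => // w []. Qed.

Let exceedanceS K n :
  exceedance K n.+1 = exceedance K n `|` [set w | K < X (tk n) w].
Proof.
apply/seteqP; split => w.
  by move=> [k]; rewrite ltnS leq_eqVlt => /orP[/eqP -> H|kn H]; [right|left; exists k].
by move=> [[k kn H]|H]; [exists k => //; exact: ltnW|exists n].
Qed.

Let filtration_gt K t u : 0 <= u -> u <= t ->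
  natural_filtration X t [set w | K < X u w].
Proof.
move=> u0 ut; have -> : [set w | K < X u w] = X u @^-1` `]K, +oo[%classic.
  by apply/seteqP; split => w; rewrite /= in_itv /= andbT.
exact: filtration_preimage.
Qed.

Let exceedance_filtration K n t : (forall k, (k < n)%N -> tk k <= t) ->
  natural_filtration X t (exceedance K n).
Proof.
elim: n => [|n IH] H; first by rewrite exceedance0; exact: filtration0.
rewrite exceedanceS; apply: filtrationU.
  by apply: IH => k kn; apply: H; exact: ltnW.
by apply: filtration_gt => //; exact: H.
Qed.

Let measurable_exceedance K n : measurable (exceedance K n).
Proof.
apply: (@filtration_measurable (tk n)); apply: exceedance_filtration => k kn.
by apply: tk_le; exact: ltnW.
Qed.

(** Doob's argument: [C] is the event that [K] is exceeded for the first time at grid point [n]. It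
    belongs to the history at that point, so its contribution can be carried forward to [T]. *)
Let maximal_aux K T n : 0 < K -> (forall k, (k < n)%N -> tk k <= T) -> 0 <= T ->
  K * fine (P x (exceedance K n)) <=
  expR (alpha * T) * \int[P x]_(w in exceedance K n) X T w.
Proof.
move=> K0 H T0; elim: n H => [|n IH] H.
  by rewrite exceedance0 measure0 mulr0 mulr_ge0 ?expR_ge0 ?Rint_ge0.
have nT : tk n <= T by exact: H.
pose C := [set w | K < X (tk n) w] `\` exceedance K n.
have mn := measurable_exceedance K n.
have FC : natural_filtration X (tk n) C.
  rewrite /C setDE; apply: filtrationI; first exact: filtration_gt.
  by apply: filtrationC; apply: exceedance_filtration => k kn; apply: tk_le; exact: ltnW.
have mC := filtration_measurable FC.
have EC : exceedance K n.+1 = exceedance K n `|` C by rewrite exceedanceS /C setUDr setDv setD0.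
have dC : exceedance K n `&` C = set0.
  by apply/seteqP; split => // w [Ew [_ /(_ Ew)]].
rewrite EC fine_probabilityU // Rintegral_setU //; last 2 first.
- by apply: process_integrable => //; exact: measurableU.
- exact/eqP.
rewrite !mulrDr; apply: lerD.
  by apply: IH => k kn; apply: H; exact: ltnW.
apply: le_trans (supermartingale_le x0 (tk0 n) nT FC).
rewrite -Rintegral_cst //; apply: le_Rintegral => //.
- by apply: (@bounded_integrable _ _ _ `|K|).
- exact: process_integrable.
- by move=> w [/ltW].
Qed.

(** With [T] the last grid time, the factor [expR (alpha * T)] cancels the decay of the mean; the
    bound depends neither on the mesh nor on the number of points. *)
Lemma maximal_inequality K n : 0 < K -> fine (P x (exceedance K n)) <= x / K.
Proof.
move=> K0; rewrite ler_pdivlMr // mulrC.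
have H k : (k < n)%N -> tk k <= tk n by move=> kn; apply: tk_le; exact: ltnW.
apply: (le_trans (maximal_aux K0 H (tk0 n))).
apply: (@le_trans _ _ (expR (alpha * tk n) * (x * expR (- (alpha * tk n))))).
  by apply: ler_wpM2l; [exact: expR_ge0|exact: process_Rintegral_le].
by rewrite mulrCA -expRD subrr expR0 mulr1.
Qed.

Let measurable_grid_increment r k :
  measurable [set w | r < X (tk k + h) w - X (tk k) w].
Proof.
have -> : [set w | r < X (tk k + h) w - X (tk k) w] =
    (fun w => X (tk k + h) w - X (tk k) w) @^-1` `]r, +oo[%classic.
  by apply/seteqP; split => w; rewrite /= in_itv /= andbT.
rewrite -[X in measurable X]setTI.
suff : measurable_fun setT (fun w => X (tk k + h) w - X (tk k) w) by apply => //.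
by apply: measurable_funB; apply: measurable_process => //; exact: addr_ge0.
Qed.

Lemma measurable_grid_jump r n : measurable (grid_jump r n).
Proof.
have -> : grid_jump r n =
    \bigcup_(k in [set k | (k < n)%N]) [set w | r < X (tk k + h) w - X (tk k) w].
  by apply/seteqP; split => w [k]; exists k.
by apply: bigcup_measurable => k _; exact: measurable_grid_increment.
Qed.

Let measurable_le K k : measurable [set w | X (tk k) w <= K].
Proof.
have -> : [set w | X (tk k) w <= K] = X (tk k) @^-1` `]-oo, K]%classic.
  by apply/seteqP; split => w; rewrite /= in_itv.
by rewrite -[X in measurable X]setTI; apply: (@measurable_process _ setT).
Qed.

(** The small-time estimate is uniform only for states up to [K]. Either some grid value exceeds
    [K], which costs [x / K], or the large increment starts below [K] and a union bound applies. *)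
Lemma grid_jump_le (r delta K kappa e : R) (n : nat) : 0 < delta -> 0 < K ->
  0 <= kappa -> 0 <= e ->
  (forall y, 0 <= y <= K ->
     fine (P y [set w | r - delta < X h w - y]) <= h * (kappa * y + e)) ->
  fine (P x (grid_jump r n)) <=
  x / K + \sum_(k < n) (h * kappa * (x * expR (- (alpha * (k%:R * h)))) + h * e).
Proof.
move=> delta0 K0 k0 e0 H.
pose B k := setT `&` [set w | X (tk k) w <= K] `&` [set w | r < X (tk k + h) w - X (tk k) w].
have mB k : measurable (B k).
  by apply: measurableI; [rewrite setTI|exact: measurable_grid_increment].
have PB k : fine (P x (B k)) <=
    h * kappa * (x * expR (- (alpha * (k%:R * h)))) + h * e.
  apply: (le_trans (one_step_le x0 (tk0 k) h0 delta0 (@filtrationT (tk k)) k0 e0 H)).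
  rewrite lerD2r; apply: ler_wpM2l; first exact: mulr_ge0.
  by apply: process_Rintegral_le => //; rewrite setTI.
pose J n := [set w | exists2 k, (k < n)%N & B k w].
have JS m : J m.+1 = J m `|` B m.
  apply/seteqP; split => w.
    by move=> [k]; rewrite ltnS leq_eqVlt => /orP[/eqP -> |kn Bk]; [right|left; exists k].
  by move=> [[k kn Bk]|Bm]; [exists k => //; exact: ltnW|exists m].
have mJ m : measurable (J m).
  have -> : J m = \bigcup_(k in [set k | (k < m)%N]) B k.
    by apply/seteqP; split => w [k]; exists k.
  by apply: bigcup_measurable.
have PJ m : fine (P x (J m)) <=
    \sum_(k < m) (h * kappa * (x * expR (- (alpha * (k%:R * h)))) + h * e).
  elim: m => [|m IH].
    have -> : J 0%N = set0 by apply/seteqP; split => // w [].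
    by rewrite measure0 big_ord0.
  rewrite JS big_ord_recr /=; apply: (le_trans (fine_probabilityU_le _ _ _)) => //.
  exact: lerD.
have := maximal_inequality n K0; move: (PJ n); set S := \sum_(k < n) _ => h1 h2.
apply: (@le_trans _ _ (fine (P x (exceedance K n `|` J n)))).
  apply: fine_probability_le; first exact: measurable_grid_jump.
    exact: measurableU.
  move=> w [k kn Hk]; have [Kk|Kk] := ltP K (X (tk k) w).
    by left; exists k.
  by right; exists k.
by apply: (le_trans (fine_probabilityU_le _ _ _)) => //; exact: lerD.
Qed.

Lemma grid_jump_ge (r delta T q kappa e : R) (n : nat) : 0 < delta -> 0 < r ->
  0 <= kappa -> 0 <= e -> n%:R * h <= T ->
  (forall y, 0 <= y <= r ->
     h * (kappa * y) <= fine (P y [set w | r + delta < X h w - y]) + h * e) ->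
  (forall C, measurable C -> fine (P x C) <= x / r -> \int[P x]_(w in C) X T w <= q) ->
  \sum_(k < n) (h * kappa * (x * expR (- (alpha * (k%:R * h))) - expR (alpha * T) * q)
     - h * e) <= fine (P x (grid_jump r n)).
Proof.
move=> delta0 r0 k0 e0 nT H Hq.
(* The index [k.+1] includes the time [tk k] itself, so on [A k] the starting state is at most [r],
   the bound that [one_step_ge] requires. *)
pose A k := ~` exceedance r k.+1.
pose B k := A k `&` [set w | r < X (tk k + h) w - X (tk k) w].
pose J n := [set w | exists2 k, (k < n)%N & B k w].
have mB k : measurable (B k).
  apply: measurableI; last exact: measurable_grid_increment.
  by apply: measurableC; exact: measurable_exceedance.
have JS m : J m.+1 = J m `|` B m.
  apply/seteqP; split => w.
    by move=> [k]; rewrite ltnS leq_eqVlt => /orP[/eqP -> |kn Bk]; [right|left; exists k].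
  by move=> [[k kn Bk]|Bm]; [exists k => //; exact: ltnW|exists m].
have mJ m : measurable (J m).
  have -> : J m = \bigcup_(k in [set k | (k < m)%N]) B k.
    by apply/seteqP; split => w [k]; exists k.
  by apply: bigcup_measurable.
have JB m : J m `&` B m = set0.
  apply/seteqP; split => // w [[k km [_ Jk]] [Am _]]; apply: Am.
  exists k.+1; first by rewrite ltnS.
  move: Jk; rewrite /= -/(tk k.+1) tkS; have := markov_ge0 hM w (tk0 k).
  by lra.
have PB k : tk k <= T ->
    h * kappa * (x * expR (- (alpha * (k%:R * h))) - expR (alpha * T) * q) - h * e
    <= fine (P x (B k)).
  move=> kT.
  have FE : natural_filtration X (tk k) (exceedance r k.+1).
    by apply: exceedance_filtration => j; rewrite ltnS; exact: tk_le.
  have AE : A k `&` [set w | X (tk k) w <= r] = A k.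
    apply/setIidl => w Aw /=; rewrite leNgt; apply/negP => rw; apply: Aw.
    by exists k.
  have := one_step_ge x0 (tk0 k) h0 delta0 (filtrationC FE) k0 e0 H.
  rewrite -/(A k) AE -lerBlDr; apply: le_trans; rewrite lerD2r.
  apply: ler_wpM2l; first exact: mulr_ge0.
  have := process_Rintegral_setC x0 (tk0 k) (measurable_exceedance r k.+1).
  rewrite -/(A k) => <-.
  suff : \int[P x]_(w in exceedance r k.+1) X (tk k) w <= expR (alpha * T) * q by lra.
  apply: (le_trans (supermartingale_le x0 (tk0 k) kT FE)).
  apply: ler_wpM2l; first exact: expR_ge0.
  by apply: Hq; [exact: measurable_exceedance|exact: maximal_inequality].
have PJ m : (m <= n)%N ->
    \sum_(k < m) (h * kappa * (x * expR (- (alpha * (k%:R * h))) - expR (alpha * T) * q)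
     - h * e) <= fine (P x (J m)).
  elim: m => [|m IH] mn; first by rewrite big_ord0 fine_ge0.
  rewrite JS fine_probabilityU // big_ord_recr /=; apply: lerD.
    by apply: IH; exact: ltnW.
  by apply: PB; apply: le_trans nT; apply: tk_le; exact: ltnW.
apply: (le_trans (PJ n (leqnn n))); apply: fine_probability_le => //.
  exact: measurable_grid_jump.
by move=> w [k kn [_ Jk]]; exists k.
Qed.

(** Both Riemann bounds telescope. Here each term is at most [alpha^-1 + h] times the decrement of
    the exponential, by [(1 + alpha * h) * expR (- (alpha * h)) <= 1]; the lower bound uses
    [1 - expR (- (alpha * h)) <= alpha * h]. *)
Lemma riemann_sum_le n : \sum_(k < n) (h * expR (- (alpha * (k%:R * h)))) <= alpha^-1 + h.
Proof.
suff H : \sum_(k < n) (h * expR (- (alpha * (k%:R * h)))) <=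
    (alpha^-1 + h) * (1 - expR (- (alpha * (n%:R * h)))).
  apply: (le_trans H); rewrite -[leRHS]mulr1; apply: ler_wpM2l.
    by rewrite addr_ge0 // invr_ge0 ltW.
  by rewrite gerBl expR_ge0.
elim: n => [|n IH]; first by rewrite big_ord0 mul0r mulr0 oppr0 expR0 subrr mulr0.
rewrite big_ord_recr /=.
have -> : - (alpha * (n.+1%:R * h)) = - (alpha * (n%:R * h)) + - (alpha * h).
  by rewrite -natr1; ring.
rewrite expRD; move: IH; set S := \sum_(k < n) _; set E := expR (- (alpha * (n%:R * h))).
move=> IH.
suff : h * E <= (alpha^-1 + h) * (E - E * expR (- (alpha * h))) by lra.
have E0 : 0 <= E by exact: expR_ge0.
have -> : (alpha^-1 + h) * (E - E * expR (- (alpha * h))) =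
  ((alpha^-1 + h) * (1 - expR (- (alpha * h)))) * E by ring.
apply: ler_wpM2r => //.
have ah0 : 0 <= alpha * h by rewrite mulr_ge0 // ltW.
have -> : alpha^-1 + h = (1 + alpha * h) / alpha.
  by field; rewrite gt_eqF.
rewrite mulrAC ler_pdivlMr // mulrBr mulr1.
have : (1 + alpha * h) * expR (- (alpha * h)) <= 1.
  rewrite expRN ler_pdivrMr ?expR_gt0 // mul1r; exact: expR_ge1Dx.
by lra.
Qed.

Lemma riemann_sum_ge n :
  (1 - expR (- (alpha * (n%:R * h)))) / alpha <=
  \sum_(k < n) (h * expR (- (alpha * (k%:R * h)))).
Proof.
elim: n => [|n IH]; first by rewrite big_ord0 mul0r mulr0 oppr0 expR0 subrr mul0r.
rewrite big_ord_recr /=.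
have -> : - (alpha * (n.+1%:R * h)) = - (alpha * (n%:R * h)) + - (alpha * h).
  by rewrite -natr1; ring.
rewrite expRD; move: IH; set S := \sum_(k < n) _; set E := expR (- (alpha * (n%:R * h))).
move=> IH; have E0 : 0 <= E by exact: expR_ge0.
have -> : (1 - E * expR (- (alpha * h))) / alpha =
  (1 - E) / alpha + E * ((1 - expR (- (alpha * h))) / alpha).
  by field; rewrite gt_eqF.
apply: lerD => //; rewrite mulrC; apply: ler_wpM2r => //.
rewrite ler_pdivrMr //; have := expRN_ge (alpha * h); lra.
Qed.

End grid.

(** * Grids of vanishing mesh *)

Lemma grid_jump_limit_le (x T r' r e : R) : 0 <= x -> 0 < T -> 0 < r' -> r' < r ->
  0 < e -> exists N0, forall N, (N0 <= N)%N ->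
  fine (P x (grid_jump (T / N.+1%:R) r N.+1)) <= x / alpha * levy_tail pi r' + e.
Proof.
move=> x0 T0 r'0 rr' e0.
pose delta := (r - r') / 2.
have delta0 : 0 < delta by rewrite divr_gt0 // subr_gt0.
(* Three errors of at most [e / 3]: exceeding [K]; the small-time error [e1], which adds up to
   [T * e1]; and the excess [kappa * x * h] of the Riemann sum. *)
pose K := 3 * x / e + 1.
have K0 : 0 < K by rewrite ltr_wpDl // divr_ge0 ?mulr_ge0 // ltW.
have xK : x / K <= e / 3.
  rewrite ler_pdivrMr // /K mulrDr.
  have -> : e / 3 * (3 * x / e) = x by field; rewrite gt_eqF.
  by lra.
pose e1 := e / 3 / T.
have e10 : 0 < e1 by rewrite !divr_gt0.
have r'd : r' < r - delta by rewrite /delta; lra.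
have [h0 h00 Hh] := small_time_jump_le r'0 r'd (ltW K0) e10.
set kappa := levy_tail pi r' in Hh *.
have kappa0 : 0 <= kappa by exact: levy_tail_ge0.
pose a := Num.min h0 (e / 3 / (kappa * x + 1)).
have kx0 : 0 <= kappa * x by exact: mulr_ge0.
have a0 : 0 < a by rewrite lt_min h00 !divr_gt0 // ltr_wpDl.
have [N0 HN] := small_step T0 a0.
exists N0 => N N0N; have := HN N N0N; set h := T / N.+1%:R.
have hpos : 0 < h by rewrite divr_gt0.
have h_ge0 : 0 <= h by exact: ltW.
rewrite /a le_min => /andP[hh0 hk].
have Hy y : 0 <= y <= K ->
    fine (P y [set w | r - delta < X h w - y]) <= h * (kappa * y + e1).
  by move=> yK; apply: Hh => //; rewrite h_ge0.
apply: (le_trans (grid_jump_le x0 h_ge0 N.+1 delta0 K0 kappa0 (ltW e10) Hy)).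
have nh : N.+1%:R * h = T by rewrite /h mulrC divfK.
have -> : \sum_(k < N.+1) (h * kappa * (x * expR (- (alpha * (k%:R * h)))) + h * e1)
    = kappa * x * \sum_(k < N.+1) (h * expR (- (alpha * (k%:R * h)))) + T * e1.
  rewrite big_split /= sumr_const card_ord -mulr_natl mulrA nh; congr (_ + _).
  by rewrite mulr_sumr; apply: eq_bigr => k _; ring.
have Te : T * e1 = e / 3 by rewrite /e1; field; rewrite gt_eqF.
have Rs := riemann_sum_le h_ge0 N.+1.
have : kappa * x * \sum_(k < N.+1) (h * expR (- (alpha * (k%:R * h)))) <=
    kappa * x * (alpha^-1 + h) by exact: ler_wpM2l.
have : kappa * x * h <= e / 3.
  have -> : e / 3 = (kappa * x + 1) * (e / 3 / (kappa * x + 1)).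
    by field; rewrite gt_eqF // ltr_wpDl.
  by apply: ler_pM => //; rewrite lerDl.
rewrite Te mulrDr.
have -> : x / alpha * kappa = kappa * x * alpha^-1 by ring.
by move: (kappa * x * _) (kappa * x * _) (kappa * x * _) => u v w; lra.
Qed.

Lemma grid_jump_limit_ge (x T r r' q e : R) : 0 <= x -> 0 < T -> 0 < r -> r < r' ->
  0 < e -> 0 <= q ->
  (forall C, measurable C -> fine (P x C) <= x / r -> \int[P x]_(w in C) X T w <= q) ->
  exists N0, forall N, (N0 <= N)%N ->
  levy_tail pi r' * (x / alpha * (1 - expR (- (alpha * T))) - T * expR (alpha * T) * q)
    <= fine (P x (grid_jump (T / N.+1%:R) r N.+1)) + e.
Proof.
move=> x0 T0 r0 rr' e0 q0 Hq.
pose delta := (r' - r) / 2.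
have delta0 : 0 < delta by rewrite divr_gt0 // subr_gt0.
pose e1 := e / T.
have e10 : 0 < e1 by rewrite divr_gt0.
have rd0 : 0 < r + delta by exact: addr_gt0.
have rdr' : r + delta < r' by rewrite /delta; lra.
(* The state bound is [r] itself, because increments are counted only before [X] exceeds [r]. *)
have [h0 h00 Hh] := small_time_jump_ge rd0 rdr' (ltW r0) e10.
set kappa := levy_tail pi r' in Hh *.
have kappa0 : 0 <= kappa by exact: levy_tail_ge0.
have [N0 HN] := small_step T0 h00.
exists N0 => N N0N; have := HN N N0N; set h := T / N.+1%:R => hh0.
have hpos : 0 < h by rewrite divr_gt0.
have h_ge0 : 0 <= h by exact: ltW.
have nh : N.+1%:R * h = T by rewrite /h mulrC divfK.
have nhT : N.+1%:R * h <= T by rewrite nh.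
have Hy y : 0 <= y <= r ->
   h * (kappa * y) <= fine (P y [set w | r + delta < X h w - y]) + h * e1.
  by move=> yr; apply: Hh => //; rewrite h_ge0.
have := grid_jump_ge x0 h_ge0 delta0 r0 kappa0 (ltW e10) nhT Hy Hq.
set Q := expR (alpha * T) * q.
have -> : \sum_(k < N.+1)
    (h * kappa * (x * expR (- (alpha * (k%:R * h))) - Q) - h * e1)
    = kappa * x * \sum_(k < N.+1) (h * expR (- (alpha * (k%:R * h))))
      - kappa * (T * Q) - e.
  have eE : e = N.+1%:R * (h * e1) by rewrite mulrA nh /e1 mulrC divfK // gt_eqF.
  have QE : kappa * (T * Q) = N.+1%:R * (h * kappa * Q) by rewrite -{1}nh; ring.
  rewrite [in RHS]eE QE sumrB sumr_const card_ord; congr (_ - _); last by rewrite mulr_natl.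
  under eq_bigr do rewrite !mulrBr.
  rewrite sumrB sumr_const card_ord; congr (_ - _); last by rewrite mulr_natl.
  by rewrite !mulr_sumr; apply: eq_bigr => k _; ring.
have Rs := riemann_sum_ge h N.+1; rewrite nh in Rs.
have : kappa * x * ((1 - expR (- (alpha * T))) / alpha) <=
    kappa * x * \sum_(k < N.+1) (h * expR (- (alpha * (k%:R * h)))).
  by apply: ler_wpM2l => //; exact: mulr_ge0.
have -> : kappa * (x / alpha * (1 - expR (- (alpha * T))) - T * expR (alpha * T) * q)
  = kappa * x * ((1 - expR (- (alpha * T))) / alpha) - kappa * (T * Q).
  by rewrite /Q; ring.
set u := kappa * x * (\sum_(k < _) _); set v := kappa * x * (_ / alpha).
by move: u v (kappa * (T * Q)) => u v w; lra.
Qed.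

(** * Jumps of a path and increments on fine grids *)

Section path.
Context (w : Omega).

Let left_limit (s : R) := lim (X u w @[u --> s^'-]).

Let right_osc (s e : R) : 0 <= s -> 0 < e ->
  exists2 a, 0 < a & forall u, s <= u -> u < s + a -> `|X s w - X u w| < e.
Proof.
move=> s0 e0; have [/(_ s s0) H _] := CB_rcll hX w.
have /cvgrPdist_lt /(_ e e0) [a /= a0 Ha] := H.
exists a => // u; rewrite le_eqVlt => /orP[/eqP <- _|su ua].
  by rewrite subrr normr0.
by apply: Ha => //=; rewrite distrC gtr0_norm ?subr_gt0 // ltrBlDl.
Qed.

Let left_osc (s e : R) : 0 < s -> 0 < e ->
  exists2 a, 0 < a & forall u, u < s -> s - a < u -> `|left_limit s - X u w| < e.
Proof.
move=> s0 e0; have [_ /(_ s s0) H] := CB_rcll hX w.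
have /cvgrPdist_lt /(_ e e0) [a /= a0 Ha] := H.
exists a => // u us ua.
by apply: Ha => //=; rewrite gtr0_norm ?subr_gt0 // ltrBlDr -ltrBlDl.
Qed.

Lemma jump_in_grid (r T s : R) : 0 < T -> 0 < s -> s <= T -> r < jump X s w ->
  exists N0, forall N, (N0 <= N)%N -> grid_jump (T / N.+1%:R) r N.+1 w.
Proof.
move=> T0 s0 sT rj; pose e := (jump X s w - r) / 2.
have e0 : 0 < e by rewrite divr_gt0 // subr_gt0.
have [a a0 Ha] := right_osc (ltW s0) e0.
have [b b0 Hb] := left_osc s0 e0.
have c0 : 0 < Num.min a b / 2 by rewrite divr_gt0 // lt_min a0.
have [N0 HN] := small_step T0 c0.
exists N0 => N N0N; have := HN N N0N; set h := T / N.+1%:R => hc.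
have h0 : 0 < h by rewrite divr_gt0.
have nh : N.+1%:R * h = T by rewrite /h mulrC divfK.
have hab : h < a /\ h < b.
  have m0 : 0 < Num.min a b by rewrite lt_min a0.
  have : h < Num.min a b by lra.
  by rewrite lt_min => /andP.
have [ha hb] := hab.
have ex : exists m, s <= m%:R * h by exists N.+1; rewrite nh.
(* The least grid point not before [s]: its predecessor lies strictly before [s] and sees the left
   limit, while the point itself may equal [s] and sees right continuity. *)
have [m sm mmin] := ex_minnP ex.
have mN : (m <= N.+1)%N by apply: mmin; rewrite nh.
case: m sm mmin mN => [|k] sm mmin mN; first by rewrite mul0r in sm; lra.
have ks : k%:R * h < s.
  by rewrite ltNge; apply/negP => /mmin; rewrite ltnn.
have kS : k.+1%:R * h = k%:R * h + h by rewrite -natr1 mulrDl mul1r.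
rewrite kS in sm.
exists k => //.
have := Ha (k%:R * h + h) sm; have := Hb (k%:R * h) ks.
have -> : s - b < k%:R * h by lra.
have -> : k%:R * h + h < s + a by lra.
move=> /(_ isT) /ltr_normlP [h1 _] /(_ isT) /ltr_normlP [_ h2].
move: h1 h2; rewrite /e /jump -/(left_limit s).
by move: (left_limit s) (X _ w) (X s w) (X _ w) => ? ? ? ?; lra.
Qed.

Let local_osc (s r r' : R) : 0 <= s -> 0 < r' -> r < r' ->
  (0 < s -> jump X s w <= r) ->
  exists2 a, 0 < a & forall u v, 0 <= u -> u <= v -> s - a < u -> v < s + a ->
    X v w - X u w < r'.
Proof.
move=> s0 r'0 rr' Hj.
(* The bound [r' / 2] handles [u] and [v] on the same side of [s]; [(r' - r) / 2] handles the case
   where they straddle [s] and the increment includes the jump. *)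
pose e := Num.min (r' / 2) ((r' - r) / 2).
have e0 : 0 < e by rewrite lt_min !divr_gt0 // subr_gt0.
have [er er'] : e <= r' / 2 /\ e <= (r' - r) / 2 by rewrite /e !ge_min !lexx orbT.
have [a a0 Ha] := right_osc s0 e0.
have right_case u v : s <= u -> u <= v -> v < s + a -> X v w - X u w < r'.
  move=> su uv va.
  have /ltr_normlP [h1 _] := Ha v (le_trans su uv) va.
  have /ltr_normlP [_ h2] := Ha u su (le_lt_trans uv va).
  by move: h1 h2; move: (X v w) (X s w) (X u w) => ? ? ?; lra.
move: s0; rewrite le_eqVlt => /orP[/eqP s0|s0].
  by exists a => // u v u0 uv _ va; apply: right_case => //; rewrite -s0.
have [b b0 Hb] := left_osc s0 e0.
exists (Num.min a b); first by rewrite lt_min a0.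
move=> u v u0 uv ub va.
have {}ub : s - b < u.
  by apply: le_lt_trans ub; rewrite lerB // ge_min lexx orbT.
have {}va : v < s + a.
  by apply: (lt_le_trans va); rewrite lerD2l ge_min lexx.
have [su|us] := leP s u; first exact: right_case.
have /ltr_normlP [_ h2] := Hb u us ub.
have [sv|vs] := leP s v.
  have /ltr_normlP [h1 _] := Ha v sv va.
  move: (Hj s0) h1 h2; rewrite /jump -/(left_limit s).
  by move: (left_limit s) (X v w) (X s w) (X u w) => ? ? ? ?; lra.
have /ltr_normlP [h1 _] := Hb v vs (lt_le_trans ub uv).
by move: h1 h2; move: (left_limit s) (X v w) (X u w) => ? ? ?; lra.
Qed.

(* Otherwise every point of the compact interval has a neighbourhood on which
   increments stay below [r']; the grid points carrying larger increments
   cluster somewhere. *)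
Lemma grid_limit_jump (r r' T : R) : 0 < T -> 0 < r' -> r < r' ->
  (forall N0, exists2 N, (N0 <= N)%N & grid_jump (T / N.+1%:R) r' N.+1 w) ->
  exists2 s, 0 < s <= T & r < jump X s w.
Proof.
move=> T0 r'0 rr' H; apply: contrapT => nj.
have Hj s : 0 < s -> s <= T -> jump X s w <= r.
  by move=> s0 sT; rewrite leNgt; apply/negP => rs; apply: nj; exists s; rewrite ?s0.
have /choice [f Hf] : forall n, exists u, exists N, [/\ (n <= N)%N, 0 <= u <= T &
    r' < X (u + T / N.+1%:R) w - X u w].
  move=> n; have [N nN [k kN Hk]] := H n.
  exists (k%:R * (T / N.+1%:R)), N; split => //.
  have h0 : 0 < T / N.+1%:R by rewrite divr_gt0.
  apply/andP; split; first by rewrite mulr_ge0 // ltW.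
  rewrite mulrA ler_pdivrMr // mulrC.
  by apply: ler_wpM2l; [exact: ltW|rewrite ler_nat; exact: ltnW].
have cpt := @segment_compact R 0 T.
have FT : (f @ \oo) `[0, T]%classic.
  by exists 0%N => // n _ /=; have [N [_ + _]] := Hf n; rewrite in_itv.
have [s [sT cl]] := cpt _ _ FT.
move: sT; rewrite /= in_itv /= => /andP[s0 sT].
have [a a0 Ha] := local_osc s0 r'0 rr' (fun s_gt0 => Hj s s_gt0 sT).
(* One half for the distance from [f n] to [s], the other for the mesh, so that both ends of the
   increment are within [a] of [s]. *)
have a20 : 0 < a / 2 by rewrite divr_gt0.
have [N0 HN0] := small_step T0 a20.
have FA : (f @ \oo) [set u | exists2 n, (N0 <= n)%N & u = f n].
  by exists N0 => // n /= N0n; exists n.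
have [u [[n N0n ->] B]] := cl _ _ FA (nbhsx_ballx s _ a20).
have [N [nN /andP[f0 fT] Hinc]] := Hf n.
have hN := HN0 N (leq_trans N0n nN).
have h0 : 0 < T / N.+1%:R by rewrite divr_gt0.
move: (T / N.+1%:R) hN h0 Hinc => h hN h0 Hinc.
move: B; rewrite /ball /= => /ltr_normlP [B1 B2].
have := Ha (f n) (f n + h) f0.
have -> : f n <= f n + h by rewrite lerDl ltW.
have -> : s - a < f n by lra.
have -> : f n + h < s + a by lra.
by move=> /(_ isT isT isT); rewrite ltNge (ltW Hinc).
Qed.

End path.

(** * Supremum of the jumps *)

Lemma fine_probability_bigcup_le (x c : R) (F : nat -> set Omega) :
  (forall n, measurable (F n)) -> (forall n m, (n <= m)%N -> F n `<=` F m) ->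
  (forall n, fine (P x (F n)) <= c) -> fine (P x (\bigcup_n F n)) <= c.
Proof.
move=> mF ndF Fc.
have H : fine (P x (F n)) @[n --> \oo] --> fine (P x (\bigcup_n F n)).
  apply: fine_cvg; rewrite fine_probabilityK; last exact: bigcup_measurable.
  apply: nondecreasing_cvg_mu => //; first exact: bigcup_measurable.
  by move=> n m nm; apply/subsetPset; exact: ndF.
rewrite -(cvg_lim _ H) //; apply: limr_le; first by apply: cvgP H.
exact: nearW.
Qed.

(** Lower limit of the grid events, with the upper limit next. For positive [T] and [r], a jump
    above [r] up to time [T] puts the path in the first, and a path in the second has a jump above
    every level below [r]. *)
Let eventually_grid (T r : R) : set Omega :=
  \bigcup_M \bigcap_(N in [set N | (M <= N)%N]) grid_jump (T / N.+1%:R) r N.+1.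

Let infinitely_grid (T r : R) : set Omega :=
  \bigcap_M \bigcup_(N in [set N | (M <= N)%N]) grid_jump (T / N.+1%:R) r N.+1.

Let jump_before (T r : R) : set Omega :=
  [set w | exists2 s, 0 < s <= T & r < jump X s w].

Let measurable_grid (T r : R) N : 0 < T ->
  measurable (grid_jump (T / N.+1%:R) r N.+1).
Proof. by move=> T0; apply: measurable_grid_jump; rewrite divr_ge0 // ltW. Qed.

Let measurable_eventually (T r : R) : 0 < T -> measurable (eventually_grid T r).
Proof.
move=> T0; apply: bigcup_measurable => M _.
by apply: bigcap_measurable => [|N _]; [by exists M => /=|exact: measurable_grid].
Qed.

(** The strict inequality leaves a margin [1/(m+1)], which turns the uncountable choice of [s] into
    countable operations on grid events; measurability follows. *)
Let jump_beforeE (T r : R) : 0 < T -> 0 < r ->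
  jump_before T r = \bigcup_m eventually_grid T (r + m.+1%:R^-1).
Proof.
move=> T0 r0; apply/seteqP; split => w.
  move=> [s /andP[s0 sT] rs].
  have js : 0 < jump X s w - r by rewrite subr_gt0.
  have [m _ /(_ m (leqnn _)) /= Hm] := near_infty_natSinv_lt (PosNum js).
  exists m => //.
  have rm : r + m.+1%:R^-1 < jump X s w by rewrite addrC -ltrBrDr.
  have [M HM] := jump_in_grid T0 s0 sT rm.
  by exists M => // N /= MN; exact: HM.
move=> [m _ [M _ HM]].
have r'0 : 0 < r + m.+1%:R^-1 by rewrite addr_gt0 // invr_gt0.
have rr' : r < r + m.+1%:R^-1 by rewrite ltrDl invr_gt0.
apply: (grid_limit_jump T0 r'0 rr') => N0.
exists (maxn M N0); first exact: leq_maxr.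
by apply: HM; exact: leq_maxl.
Qed.

Let measurable_jump_before (T r : R) : 0 < T -> 0 < r ->
  measurable (jump_before T r).
Proof.
move=> T0 r0; rewrite jump_beforeE //.
by apply: bigcup_measurable => m _; exact: measurable_eventually.
Qed.

Lemma sup_jump_gtE (r : R) :
  [set w | (r%:E < sup_jump X w)%E] = \bigcup_n jump_before n.+1%:R r.
Proof.
apply/seteqP; split => w.
  move=> /= /ereal_sup_gt [_ [s /= + <-]]; rewrite in_itv /= andbT lte_fin => s0 rs.
  exists (Num.bound s) => //; exists s => //; rewrite s0 /=.
  apply: ltW; apply: (lt_trans (archi_boundP (ltW s0))).
  by rewrite ltr_nat.
move=> [n _ [s /andP[s0 _] rs]] /=; apply: (@lt_le_trans _ _ (jump X s w)%:E).
  by rewrite lte_fin.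
by apply: ereal_sup_ubound; exists s => //=; rewrite in_itv /= s0.
Qed.

Lemma measurable_sup_jump_gt (r : R) : 0 < r ->
  measurable [set w | (r%:E < sup_jump X w)%E].
Proof.
move=> r0; rewrite sup_jump_gtE.
by apply: bigcup_measurable => n _; exact: measurable_jump_before.
Qed.

(** A uniform bound survives the three increasing unions, over horizon, margin and rank of the grid.
    Every threshold [r + 1/(m+1)] lies above [r], so the grid estimate applies with the tail at [r]
    itself. *)
Lemma sup_jump_le (x r : R) : 0 <= x -> 0 < r ->
  fine (P x [set w | (r%:E < sup_jump X w)%E]) <= x / alpha * levy_tail pi r.
Proof.
move=> x0 r0; rewrite sup_jump_gtE.
apply: fine_probability_bigcup_le.
- by move=> n; exact: measurable_jump_before.
- move=> n m nm w [s /andP[s0 sn] rs]; exists s => //; rewrite s0 /=.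
  by apply: (le_trans sn); rewrite ler_nat.
move=> n; have T0 : 0 < n.+1%:R :> R by [].
move: (n.+1%:R) T0 => T T0 {n}.
rewrite jump_beforeE //; apply: fine_probability_bigcup_le.
- by move=> m; exact: measurable_eventually.
- move=> m m' mm' w [M _ HM]; exists M => // N MN.
  have [k kN Hk] := HM N MN; exists k => //; apply: le_lt_trans Hk.
  by rewrite lerD2l lef_pV2 ?posrE // ler_nat.
move=> m; have rr : r < r + m.+1%:R^-1 by rewrite ltrDl invr_gt0.
move: (r + _) rr => r' rr' {m}.
apply: fine_probability_bigcup_le.
- by move=> M; apply: bigcap_measurable => [|N _]; [by exists M => /=|exact: measurable_grid].
- by move=> M M' MM' w HM N /= MN; apply: HM; exact: leq_trans MM' MN.
move=> M; apply/ler_addgt0Pr => e e0.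
have [N0 HN] := grid_jump_limit_le x0 T0 r0 rr' e0.
apply: le_trans (HN (maxn M N0) (leq_maxr _ _)).
apply: fine_probability_le.
- by apply: bigcap_measurable => [|N _]; [exists M => /=|exact: measurable_grid].
- exact: measurable_grid.
- by move=> w; apply; exact: leq_maxl.
Qed.

(** The event that infinitely many grids carry an increment above [r1] forces a jump above [r], and
    its probability is no less than the limiting lower bound on the grid probabilities. *)
Lemma sup_jump_ge (x T r q : R) : 0 <= x -> 0 < T -> 0 < r -> 0 <= q ->
  (forall C, measurable C -> fine (P x C) <= x / r -> \int[P x]_(w in C) X T w <= q) ->
  0 <= x / alpha * (1 - expR (- (alpha * T))) - T * expR (alpha * T) * q ->
  levy_tail pi r * (x / alpha * (1 - expR (- (alpha * T))) - T * expR (alpha * T) * q)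
    <= fine (P x [set w | (r%:E < sup_jump X w)%E]).
Proof.
move=> x0 T0 r0 q0 Hq; set c := (_ - _); rewrite le_eqVlt => /orP[/eqP <-|c0].
  by rewrite mulr0 fine_ge0.
(* If the bound failed at [r], right continuity would make it fail with the tail taken at some
   [r2 > r]; this leaves room for [r1] in between. *)
rewrite leNgt -ltr_pdivrMr //; apply/negP => /(levy_tail_cont hPhi r0) [r2 rr2].
rewrite ltr_pdivrMr //; apply/negP; rewrite -leNgt.
pose r1 := (r + r2) / 2.
have rr1 : r < r1 by rewrite /r1; lra.
have r12 : r1 < r2 by rewrite /r1; lra.
have r10 : 0 < r1 by exact: lt_trans rr1.
have Hq1 C : measurable C -> fine (P x C) <= x / r1 -> \int[P x]_(w in C) X T w <= q.
  move=> mC PC; apply: Hq => //; apply: (le_trans PC); apply: ler_wpM2l => //.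
  by rewrite lef_pV2 ?posrE // ltW.
have minf : measurable (infinitely_grid T r1).
  apply: bigcap_measurable => [|M _]; first by exists 0%N.
  by apply: bigcup_measurable => N _; exact: measurable_grid.
apply: (@le_trans _ _ (fine (P x (infinitely_grid T r1)))); last first.
  apply: fine_probability_le => //; first exact: measurable_sup_jump_gt.
  rewrite sup_jump_gtE => w Hw.
  have [s /andP[s0 sT] rs] : exists2 s, 0 < s <= T & r < jump X s w.
    apply: (grid_limit_jump T0 r10 rr1) => N0.
    by have [N /= N0N HN] := Hw N0 I; exists N.
  exists (Num.bound T) => //; exists s => //; rewrite s0 /=.
  apply: (le_trans sT); apply: ltW; apply: (lt_trans (archi_boundP (ltW T0))).
  by rewrite ltr_nat.
(* The complement of the upper limit is an increasing union, so a uniform bound passes to it. *)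
suff : fine (P x (~` infinitely_grid T r1)) <= 1 - levy_tail pi r2 * c.
  rewrite probability_setC // fineB ?fin_num_measure //= lerD2l lerN2 //.
rewrite /infinitely_grid setC_bigcap; apply: fine_probability_bigcup_le.
- move=> M; apply: measurableC; apply: bigcup_measurable => N _.
  exact: measurable_grid.
- move=> M M' MM' w HM [N MN HN]; apply: HM; exists N => //.
  exact: leq_trans MM' MN.
move=> M; rewrite probability_setC; last first.
  by apply: bigcup_measurable => N _; exact: measurable_grid.
have mU : measurable (\bigcup_(N in [set N | (M <= N)%N]) grid_jump (T / N.+1%:R) r1 N.+1).
  by apply: bigcup_measurable => N _; exact: measurable_grid.
rewrite fineB ?fin_num_measure //= lerD2l lerN2.
apply/ler_addgt0Pr => e e0.
have [N0 HN] := grid_jump_limit_ge x0 T0 r10 r12 e0 q0 Hq1.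
apply: (le_trans (HN (maxn M N0) (leq_maxr _ _))); rewrite lerD2r.
apply: fine_probability_le => //; first exact: measurable_grid.
by move=> w Hw; exists (maxn M N0) => //=; exact: leq_maxl.
Qed.

Lemma small_event_mean (x T e : R) : 0 <= x -> 0 < T -> 0 < e ->
  exists2 r0, 0 < r0 & forall r C, r0 <= r -> measurable C ->
    fine (P x C) <= x / r -> \int[P x]_(w in C) X T w <= e.
Proof.
move=> x0 T0 e0.
have iX : (P x).-integrable setT (EFin \o X T) by apply: process_integrable => //; exact: ltW.
have [a [a0 Ha]] := integral_normr_continuous iX e0.
(* For [r] beyond this value [x / r] is below [a], the size allowed by absolute continuity of the
   integral. *)
have r00 : 0 < x / a + 1 by rewrite ltr_wpDl // divr_ge0 // ltW.
exists (x / a + 1) => // r C rr mC PC.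
have r0 : 0 < r by exact: lt_le_trans rr.
have xr : x / r < a.
  rewrite ltr_pdivrMr //; apply: (@lt_le_trans _ _ (a * (x / a + 1))).
    by rewrite mulrDr mulr1 mulrC divfK ?gt_eqF // ltrDl.
  by rewrite ler_pM2l.
have PCa : (P x C < a%:E)%E.
  by rewrite -fine_probabilityK // lte_fin; exact: le_lt_trans PC xr.
have := Ha C mC PCa; move=> /ltW; apply: le_trans; rewrite le_eqVlt; apply/orP; left; apply/eqP.
by apply: eq_Rintegral => w _; rewrite ger0_norm // (markov_ge0 hM) // ltW.
Qed.

Lemma sup_jump_asymp_ge (x eta : R) : 0 < x -> 0 < eta -> eta < 1 ->
  exists2 r0, 0 < r0 & forall r, r0 <= r ->
    (1 - eta) * (x / alpha * levy_tail pi r) <=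
    fine (P x [set w | (r%:E < sup_jump X w)%E]).
Proof.
move=> x0 eta0 eta1.
(* Then [expR (alpha * T) >= alpha * T = 2 / eta], so the mass left after [T] costs a proportion of
   at most [eta / 2]. *)
pose T := (alpha * (eta / 2))^-1.
have ae0 : 0 < alpha * (eta / 2) by rewrite mulr_gt0 // divr_gt0.
have T0 : 0 < T by rewrite invr_gt0.
have eT : expR (- (alpha * T)) <= eta / 2.
  rewrite expRN invf_ple ?posrE ?expR_gt0 ?divr_gt0 //.
  apply: le_trans (expR_ge1Dx _).
  have -> : alpha * T = (eta / 2)^-1.
    by rewrite /T invfM mulrA divff ?mul1r // gt_eqF.
  by rewrite lerDr.
(* The loss on paths that exceed [r] takes the other [eta / 2]. *)
pose q := x / alpha * (eta / 2) / (T * expR (alpha * T)).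
have TE0 : 0 < T * expR (alpha * T) by rewrite mulr_gt0 // expR_gt0.
have xa0 : 0 < x / alpha by rewrite divr_gt0.
have q0 : 0 < q by rewrite divr_gt0 // mulr_gt0 // divr_gt0.
have [r0 r00 Hr] := small_event_mean (ltW x0) T0 q0.
exists r0 => // r rr; have rpos := lt_le_trans r00 rr.
have qE : T * expR (alpha * T) * q = x / alpha * (eta / 2).
  by rewrite /q mulrC divfK // gt_eqF.
have h : x / alpha * (1 - eta) <=
    x / alpha * (1 - expR (- (alpha * T))) - T * expR (alpha * T) * q.
  by rewrite qE -mulrBr ler_pM2l //; lra.
have Hq C : measurable C -> fine (P x C) <= x / r -> \int[P x]_(w in C) X T w <= q.
  exact: Hr.
have := sup_jump_ge (ltW x0) T0 rpos (ltW q0) Hq.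
set c := x / alpha * (1 - expR _) - _ in h *.
have c0 : 0 <= c by apply: le_trans h; rewrite mulr_ge0 ?(ltW xa0) //; lra.
move=> /(_ c0); apply: le_trans.
have -> : (1 - eta) * (x / alpha * levy_tail pi r) =
  levy_tail pi r * (x / alpha * (1 - eta)) by ring.
by apply: ler_wpM2l => //; exact: levy_tail_ge0.
Qed.

End process.

Theorem theorem3p7 (R : realType) (alpha beta : R)
    (pi : {measure set R -> \bar R})
    (d : measure_display) (Omega : measurableType d)
    (X : R -> Omega -> R) (P : R -> probability Omega R) (x : R)
    (hPhi : is_branching_triple alpha beta pi)
    (hX : is_CB_process (branching_mechanism alpha beta pi) X P)
    (hx : 0 < x) (halpha : 0 < alpha)
    (hpi : ~ bounded_set (measure_support pi)) :
  asymp_equiv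
    (fun r : R => fine (P x [set w | (r%:E < sup_jump X w)%E]))
    (fun r : R => x / alpha * fine (pi `]r, +oo[%classic)).
Proof.
apply/cvgrPdist_le => e e0.
pose eta := Num.min e (1 / 2).
have eta0 : 0 < eta by rewrite lt_min e0 /=; lra.
have eta1 : eta < 1 by rewrite gt_min; apply/orP; right; lra.
have [r0 r00 Hr] := sup_jump_asymp_ge hPhi halpha hX hx eta0 eta1.
near=> r.
have rr0 : r0 <= r by near: r; apply: nbhs_pinfty_ge; exact: num_real.
have rpos := lt_le_trans r00 rr0.
have t0 := levy_tail_gt0 hPhi rpos hpi.
have g0 : 0 < x / alpha * levy_tail pi r by rewrite mulr_gt0 // divr_gt0.
have up := sup_jump_le hPhi halpha hX (ltW hx) rpos.
have low := Hr r rr0.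
apply: (@le_trans _ _ eta); last by rewrite ge_min lexx.
(* The upper bound makes the quotient at most [1], so its distance to [1] is controlled by the lower
   bound alone. *)
rewrite -/(levy_tail pi r) ger0_norm; last by rewrite subr_ge0 ler_pdivrMr // mul1r.
by rewrite lerBlDr -lerBlDl ler_pdivlMr.
Unshelve. all: by end_near. Qed.
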